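(* Let $K$ be a field, let $G$ be a finite simple connected graph, and let $\mathrm{Cut}^\Box(G)$ be its cut polytope. Then the following conditions are equivalent: (i) $G$ has no $K_4$-minors; (ii) the toric ideal $I_{\mathrm{Cut}^\Box(G)}$ is quadratic; (iii) $\mathrm{Cut}^\Box(G)$ has the clique-face property; (iv) $I_{\mathrm{Cut}^\Box(G)}$ has no indispensable monomials of degree $\ge 3$; (v) $I_{\mathrm{Cut}^\Box(G)}$ has no indispensable binomials of degree $\ge 3$.
   Context: Cut polytope: let $G$ have vertex set $V=\{1,\dots,n\}$ and edge set $E$. For $S\subset V$ let $\delta_G(S)=(d_{ij})_{\{i,j\}\in E}\in\{0,1\}^E$ with $d_{ij}=1$ if $|S\cap\{i,j\}|=1$ and $d_{ij}=0$ otherwise. Then $\mathrm{Cut}^\Box(G)=\mathrm{conv}\{\delta_G(S):S\subset V\}\subset\mathbb{R}^E$. Clique-face property: the $1$-skeleton $\mathrm{sk}(P)$ of a polytope $P$ is the simple graph on the vertices of $P$ with $v\ne w$ adjacent iff $\mathrm{conv}(\{v,w\})$ is an edge of $P$. $P$ has the clique-face property if every clique (vertex set of a complete subgraph) of $\mathrm{sk}(P)$ is the vertex set of a face of $P$, where $P$ itself is regarded as a face. Toric ideal: for a lattice polytope $P\subset\mathbb{R}^d$ with $P\cap\mathbb{Z}^d=\{\mathbf{a}_1,\dots,\mathbf{a}_N\}$, $I_P$ is the kernel of the $K$-algebra homomorphism $K[x_1,\dots,x_N]\to K[t_1^{\pm1},\dots,t_d^{\pm1},s]$, $x_i\mapsto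 \mathbf{t}^{\mathbf{a}_i}s$ (here with $\mathbb{R}^E$ in place of $\mathbb{R}^d$). A binomial is a difference of two distinct monomials. $I_P$ is quadratic if it is generated by homogeneous binomials of degree $2$ (the zero ideal counts as quadratic). A binomial $f\in I_P$ is indispensable if every system of binomial generators of $I_P$ contains $f$ or $-f$. A monomial $m$ is indispensable for $I_P$ if every system of binomial generators of $I_P$ contains a binomial having $m$ as one of its two monomials. *)

(* Defs.v *)
From HB Require Import structures.
From mathcomp Require Import all_boot all_order all_algebra.
From mathcomp Require Import boolp classical_sets reals.
From mathcomp Require Import mpoly.

Set Implicit Arguments.
Unset Strict Implicit.
Unset Printing Implicit Defensive.

Import Order.TTheory GRing.Theory Num.Theory.

Section Graphs.
Variables (V : finType) (e : rel V).

Definition connected_in (B : {set V}) :=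
  B != finset.set0 /\
  {in B &, forall x y,
    connect [rel u v | [&& e u v, u \in B & v \in B]] x y}.

Definition connected_graph := connected_in [set: V].

(* Minors are given by branch sets: H is a minor of G when the vertices of H
   can be replaced by disjoint connected vertex sets of G so that every edge
   of H is realized by an edge of G between the corresponding sets. *)
Definition has_minor (W : finType) (h : rel W) :=
  exists B : W -> {set V},
    [/\ forall i, connected_in (B i),
        forall i j, i != j -> [disjoint B i & B j]
      & forall i j, h i j -> exists x y, [/\ x \in B i, y \in B j & e x y]].

Definition complete_graph (n : nat) : rel 'I_n := fun i j => i != j.

Definition edge_set : {set {set V}} :=
  [set [set p.1; p.2] | p : V * V & e p.1 p.2].

End Graphs.

Arguments complete_graph n i j : clear implicits.

Local Open Scope ring_scope.
Local Open Scope classical_set_scope.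

Section Polytopes.
Variables (R : realType) (d : nat).
Implicit Types (A P F : set 'rV[R]_d).

Definition conv A : set 'rV[R]_d :=
  [set x | exists (n : nat) (w : 'I_n -> R) (p : 'I_n -> 'rV[R]_d),
     [/\ forall i, 0 <= w i, \sum_i w i = 1, forall i, A (p i)
       & x = \sum_i w i *: p i]].

Definition dot (c x : 'rV[R]_d) : R := \sum_j c 0 j * x 0 j.

(* The inequality 0 <= 0 makes P a face of itself, and 0 <= 1 makes the empty
   set a face. *)
Definition is_face P F :=
  exists (c : 'rV[R]_d) (b : R),
    (forall x, P x -> dot c x <= b) /\ F = P `&` [set x | dot c x = b].

Definition vertices P : set 'rV[R]_d := [set v | is_face P [set v]].

(* For v <> w the segment conv {v, w} is one-dimensional, so that it is an edge
   of P as soon as it is a face of P. *)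
Definition skeleton_adj P (v w : 'rV[R]_d) :=
  [/\ vertices P v, vertices P w, v <> w & is_face P (conv [set v; w])].

Definition skeleton_clique P (C : set 'rV[R]_d) :=
  C `<=` vertices P /\
  (forall v w, C v -> C w -> v <> w -> skeleton_adj P v w).

Definition clique_face_property P :=
  forall C, skeleton_clique P C -> exists2 F, is_face P F & vertices F = C.

(* a_0, ..., a_(N-1) lists the points of P `&` Z^d, without repetition. *)
Definition lattice_points P (N : nat) (a : 'I_N -> 'rV[int]_d) :=
  injective a /\
  forall z : 'rV[int]_d, P (map_mx intr z) <-> exists i, a i = z.

End Polytopes.

Section CutPolytope.
Variables (R : realType) (V : finType) (e : rel V).

(* The coordinates of R^E are numbered by the enumeration enum_val of E. *)
Definition cut_vector (S : {set V}) : 'rV[R]_#|edge_set e| :=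
  \row_j (#|S :&: enum_val j| == 1%N)%:R.

Definition cut_polytope : set 'rV[R]_#|edge_set e| := conv (range cut_vector).

(* The lattice points of the cut polytope can be listed as in lattice_points:
   they are 0/1-vectors. *)
Lemma cut_lattice_points_exist :
  exists (N : nat) (a : 'I_N -> 'rV[int]_#|edge_set e|),
    lattice_points cut_polytope a.
Proof.
set d := #|edge_set e|.
pose f (b : 'rV[bool]_d) : 'rV[int]_d := map_mx (fun c : bool => (c : nat)%:Z) b.
have f_inj : injective f.
  move=> b b' /matrixP fbb'; apply/matrixP=> i j.
  by have := fbb' i j; rewrite !mxE; do 2!case: (_ i j).
pose A := [set b : 'rV[bool]_d | `[< cut_polytope (map_mx intr (f b)) >]]%SET.
exists #|A|, (fun i : 'I_#|A| => f (enum_val i)); split.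
  by move=> i j /f_inj /enum_val_inj.
move=> z; split=> [Pz|[i <-]]; last first.
  by have := enum_valP i; rewrite inE => /asboolP.
have z01 j : (0 <= z 0 j <= 1)%R.
  case: Pz => n [w [p [w0 w1 pA zE]]].
  have p01 i : (0 <= p i 0 j <= 1)%R.
    by have [S _ <-] := pA i; rewrite mxE; case: (_ == _); rewrite /= ?lexx ler01.
  have /matrixP/(_ 0 j) := zE; rewrite mxE summxE => zj.
  rewrite -(ler0z R) -(lerz1 R) zj; apply/andP; split.
    apply: sumr_ge0 => i _; rewrite mxE mulr_ge0 //.
    by case/andP: (p01 i).
  rewrite -[leRHS]w1; apply: ler_sum => i _; rewrite mxE ler_piMr //.
  by case/andP: (p01 i).
pose b : 'rV[bool]_d := map_mx (fun x : int => x == 1) z.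
have fb : f b = z.
  apply/matrixP => i j; rewrite !mxE (ord1 i).
  by have := z01 j; case: (z 0 j) => [[|[|k]]|k].
have bA : b \in A by rewrite inE fb; apply/asboolP.
by exists (enum_rank_in bA b); rewrite enum_rankK_in.
Qed.

End CutPolytope.

Arguments cut_polytope R {V} e.

Section BinomialIdeals.
Variables (K : fieldType) (N : nat).
Implicit Types (I S : set {mpoly K[N]}) (f : {mpoly K[N]}) (m : 'X_{1..N}).

Definition ideal_span S : set {mpoly K[N]} :=
  [set f | exists (n : nat) (g h : 'I_n -> {mpoly K[N]}),
     (forall i, S (h i)) /\ f = \sum_i g i * h i].

Definition is_binomial f :=
  exists m1 m2 : 'X_{1..N}, m1 != m2 /\ f = 'X_[m1] - 'X_[m2].

Definition binomial_generators I S :=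
  (forall f, S f -> is_binomial f) /\ ideal_span S = I.

Definition quadratic I :=
  exists2 S, binomial_generators I S & forall f, S f -> f \is 2.-homog.

Definition indispensable_binomial I f :=
  [/\ I f, is_binomial f & forall S, binomial_generators I S -> S f \/ S (- f)].

Definition indispensable_monomial I m :=
  forall S, binomial_generators I S -> exists2 f, S f & m \in msupp f.

End BinomialIdeals.

Section ToricIdeal.
Variables (K : fieldType) (d N : nat) (a : 'I_N -> 'rV[int]_d).

(* The Laurent ring K[t_1^+-1, ..., t_d^+-1, s] is taken inside the fraction
   field of K[t_1, ..., t_d, s]; the last variable is s. *)
Definition toric_var (j : 'I_d.+1) : {fraction {mpoly K[d.+1]}} :=
  tofrac ('X_j : {mpoly K[d.+1]}).

Definition toric_monomial (i : 'I_N) : {fraction {mpoly K[d.+1]}} :=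
  (\prod_(j < d) toric_var (lift ord_max j) ^ a i 0 j) * toric_var ord_max.

Definition toric_map (f : {mpoly K[N]}) : {fraction {mpoly K[d.+1]}} :=
  mmap (fun c : K => tofrac (c%:MP : {mpoly K[d.+1]})) toric_monomial f.

Definition toric_ideal : set {mpoly K[N]} := [set f | toric_map f = 0].

End ToricIdeal.

Arguments toric_ideal K {d N} a.

(* Main.v *)
Require Import Defs.
From mathcomp Require Import all_boot all_order all_algebra.
From mathcomp Require Import boolp classical_sets reals.
From mathcomp Require Import mpoly zify ring lra.

Set Implicit Arguments.
Unset Strict Implicit.
Unset Printing Implicit Defensive.

(** The toric ideal is spanned by the differences of two monomials of the same
    fibre: two monomials, i.e. two multisets of cuts, are in the same fibre
    when they have the same degree and cover every edge equally often
    ([toric_span], [toric_binomial]).  All five conditions are statements about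
    these fibres.

    No K4 minor implies quadratic.  The ideal is quadratic as soon as any two
    multisets of a fibre are joined by steps that replace two cuts at a time.
    For graphs without K4 minor this is proved along a decomposition of the
    graph.  A part B hanging between two vertices u and w, which are moreover
    joined outside B, is a union of parts between u and w with no edges among
    them, or hangs at one of u and w only, or has a vertex x that separates u
    from w; otherwise two disjoint connections from u to w inside B and the
    connection outside give a K4 minor ([cut_vertex]).  When two networks are
    glued along an edge, the exchange steps of each lift to the union
    ([lift_fiber_conn], [fibers_connected_glue]): this is a toric fibre
    product.  The edge used for gluing need not belong to the graph, and it has
    to be deleted afterwards.  Deleting it makes fibres larger: multisets now
    differ in how often they cut the deleted edge uw.  The induction therefore
    carries, besides the connectedness of the fibres of the network with uw
    added, the property [reducible]: a multiset that cuts uw at least twice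
    more often than another one of its fibre can be brought to a form in which
    one exchange of two cuts lowers this number by two.  The two properties
    together survive gluing along uw and composition in series, and imply that
    uw can be deleted ([fibers_connected_delete], [reducible_series],
    [fibers_connected_series]).

    Quadratic implies the clique-face property.  If C is a clique of the
    skeleton, a quadratic binomial of the ideal one of whose monomials is
    supported on C must be zero, because the midpoint of an edge of a 0/1
    polytope is the midpoint of no other pair of vertices.  Hence evaluation at
    the indicator of C kills the whole ideal, so that a fibre containing a
    monomial supported on C has all its monomials supported on C
    ([clique_fiber]).  By Farkas' lemma over the rationals this says that some
    linear form is maximal on the cut polytope exactly along C.

    The clique-face property excludes indispensable monomials of degree at
    least 3.  An indispensable monomial m is not alone in its fibre, but all
    its proper divisors are.  For cuts u in the smallest face of the cube
    containing two cuts v and w, v + w - u is again a cut (a symmetric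
    difference), so v and w are adjacent when x_v x_w is alone in its fibre
    ([point_edge]).  Thus the support of m is a clique, hence a face, which
    contains the support of every other monomial of the fibre; cancelling a
    common variable contradicts the minimality of m.

    An indispensable binomial consists of indispensable monomials.  Finally, if
    G has a K4 minor, its branch sets can be enlarged to a partition of the
    vertices; the cuts that are unions of branch sets form a face isomorphic to
    the cut polytope of K4, and the fibre of x_{} x_{12} x_{13} x_{23} consists
    of two coprime monomials of degree 4 ([k4_fiber]), whose difference is
    indispensable. *)

(** * Exchange moves and toric fibre products *)

Section Fibers.
Import mathcomp.boot.fintype mathcomp.boot.finset.
Variables (X : eqType) (E : finType) (c : E -> X -> bool).
Implicit Types (S T R A B : seq X) (F : {set E}).

(** [c p x] says that the state [x] uses the coordinate [p]; a sequence of
    states stands for a multiset. *)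
Definition agree F S T :=
  size S = size T /\ {in F, forall p, count (c p) S = count (c p) T}.

(** Moves that exchange a single state are included because different states may
    agree on all coordinates of F. *)
Inductive fiber_conn F : seq X -> seq X -> Prop :=
| Fiber_perm S T of perm_eq S T : fiber_conn F S T
| Fiber_move A B R of size A <= 2 & agree F A B :
    fiber_conn F (A ++ R) (B ++ R)
| Fiber_trans S T R of fiber_conn F S T & fiber_conn F T R : fiber_conn F S R.

Definition fibers_connected F := forall S T, agree F S T -> fiber_conn F S T.

(** What the coordinates of F can see of a state; multisets of keys are compared
    with [perm_eq]. *)
Definition key F x : {set E} := [set p in F | c p x].

Lemma keyP F x y : reflect {in F, c ^~ x =1 c ^~ y} (key F x == key F y).
Proof.
apply: (iffP eqP) => [/setP k p Fp | k].
  by have := k p; rewrite !inE Fp.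
by apply/setP=> p; rewrite !inE; case Fp: (p \in F); rewrite //= k.
Qed.

Lemma agree_refl F S : agree F S S. Proof. by split. Qed.

Lemma agree_sym F S T : agree F S T -> agree F T S.
Proof. by case=> sz ct; split=> // p /ct. Qed.

Lemma agree_trans F S T R : agree F S T -> agree F T R -> agree F S R.
Proof. by case=> s1 c1 [s2 c2]; split=> [|p Fp]; rewrite ?s1 // c1 ?c2. Qed.

Lemma agree_cat F S S' T T' :
  agree F S T -> agree F S' T' -> agree F (S ++ S') (T ++ T').
Proof.
case=> s1 c1 [s2 c2]; split=> [|p Fp]; first by rewrite !size_cat s1 s2.
by rewrite !count_cat c1 ?c2.
Qed.

Lemma agree_perm F S T : perm_eq S T -> agree F S T.
Proof. by move=> st; split=> [|p _]; [exact: perm_size | exact: (permP st)]. Qed.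

Lemma agreeS F F' S T : F' \subset F -> agree F S T -> agree F' S T.
Proof. by move=> /subsetP sF [sz ct]; split=> // p /sF /ct. Qed.

Lemma agree_key F S T :
  perm_eq (map (key F) S) (map (key F) T) -> agree F S T.
Proof.
move=> st; split; first by have := perm_size st; rewrite !size_map.
move=> p Fp; have := permP st (fun k => p \in k).
by rewrite !count_map; congr (_ = _); apply: eq_count => x /=; rewrite inE Fp.
Qed.

Lemma agreeU F1 F2 S T : agree F1 S T -> agree F2 S T -> agree (F1 :|: F2) S T.
Proof. by case=> sz c1 [_ c2]; split=> // p /setUP[/c1|/c2]. Qed.

Lemma agreeU1 e F S T :
  count (c e) S = count (c e) T -> agree F S T -> agree (e |: F) S T.
Proof. by move=> ce [sz cF]; split=> // p /setU1P[->|/cF]. Qed.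

Lemma fiber_conn_agree F S T : fiber_conn F S T -> agree F S T.
Proof.
elim=> [{}S {}T /agree_perm// | A B R _ AB | S1 T1 R _ + _ ].
  exact: agree_cat (agree_refl _ _).
exact: agree_trans.
Qed.

Lemma fiber_conn_refl F S : fiber_conn F S S.
Proof. exact: Fiber_perm. Qed.

Lemma fiber_conn_sym F S T : fiber_conn F S T -> fiber_conn F T S.
Proof.
elim=> [{}S {}T|A B R sA AB|S1 T1 R _ + _ ].
- by rewrite perm_sym; apply: Fiber_perm.
- by apply: Fiber_move (agree_sym AB); case: AB => <-.
- by move=> ? ?; apply: Fiber_trans; eassumption.
Qed.

Lemma fiber_connS F F' S T : F' \subset F -> fiber_conn F S T -> fiber_conn F' S T.
Proof.
move=> sF; elim=> [{}S {}T|A B R sA /(agreeS sF) AB|S1 T1 R _ + _ ].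
- exact: Fiber_perm.
- exact: Fiber_move.
- exact: Fiber_trans.
Qed.

Lemma fiber_conn_cons F x S T : fiber_conn F S T -> fiber_conn F (x :: S) (x :: T).
Proof.
elim=> [{}S {}T|A B R sA AB|S1 T1 R _ + _ ].
- by rewrite -(perm_cons x); apply: Fiber_perm.
- have perm_mid D : perm_eq (x :: D ++ R) (D ++ x :: R).
    by rewrite perm_sym perm_catC /= perm_cons perm_catC.
  apply: (Fiber_trans (Fiber_perm _ (perm_mid A))).
  apply: (Fiber_trans (Fiber_move (x :: R) sA AB)).
  by apply: Fiber_perm; rewrite perm_sym.
- exact: Fiber_trans.
Qed.

Lemma fiber_conn1 F x y R :
  {in F, c ^~ x =1 c ^~ y} -> fiber_conn F (x :: R) (y :: R).
Proof.
move=> xy; apply: (@Fiber_move _ [:: x] [:: y]) => //.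
by split=> // p /xy /= ->.
Qed.

Lemma perm_map_split (K : eqType) (f : X -> K) S (U1 U2 : seq K) :
  perm_eq (map f S) (U1 ++ U2) ->
  exists S1 S2, [/\ perm_eq S (S1 ++ S2), map f S1 = U1 & map f S2 = U2].
Proof.
elim: U1 S => [|k U1 IH] S /= SU.
  have [S2 SS2 fS2] : exists2 S2, perm_eq S S2 & map f S2 = U2.
    elim: U2 S SU => [|k U2 IH] S SU.
      by exists [::] => //; move/perm_size: SU; case: S.
    have /mapP[x Sx kx] : k \in map f S by rewrite (perm_mem SU) mem_head.
    have Sx' := perm_to_rem Sx.
    have /IH[S2 S2p fS2] : perm_eq (map f (rem x S)) U2.
      rewrite -(perm_cons k) {1}kx -map_cons.
      by rewrite -(permPl (perm_map f Sx')).
    by exists (x :: S2); rewrite ?(permPl Sx') ?perm_cons //= fS2 kx.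
  by exists [::], S2.
have /mapP[x Sx kx] : k \in map f S by rewrite (perm_mem SU) mem_head.
have Sx' := perm_to_rem Sx.
have /IH[S1 [S2 [S12 fS1 fS2]]] : perm_eq (map f (rem x S)) (U1 ++ U2).
  by rewrite -(perm_cons k) {1}kx -map_cons -(permPl (perm_map f Sx')).
by exists (x :: S1), S2; rewrite (permPl Sx') /= perm_cons fS1 kx.
Qed.

(** The situation of a toric fibre product: two networks with coordinates F1 and
    F2 that share only the edge e. *)
Definition glues F1 F2 e := forall x y, c e x = c e y ->
  exists2 z, {in e |: F1, c ^~ z =1 c ^~ x} & {in e |: F2, c ^~ z =1 c ^~ y}.

Lemma glues_sym F1 F2 e : glues F1 F2 e -> glues F2 F1 e.
Proof. by move=> g x y xy; have [z zy zx] := g y x (esym xy); exists z. Qed.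

Lemma realize_keys F1 F2 e A B : glues F1 F2 e ->
  size A = size B -> count (c e) A = count (c e) B ->
  exists2 R, map (key (e |: F1)) R = map (key (e |: F1)) A
           & perm_eq (map (key (e |: F2)) R) (map (key (e |: F2)) B).
Proof.
move=> glue; elim: A B => [|x A IH] B szAB ctAB.
  by exists [::] => //; case: B szAB {ctAB}.
have [y By xy] : exists2 y, y \in B & c e x = c e y.
  case cx: (c e x).
    have /hasP[y By cy] : has (c e) B by rewrite has_count -ctAB /= cx.
    by exists y.
  have /hasP[y By /= /negbTE cy] : has (predC (c e)) B.
    have := count_predC (c e) B; have := count_predC (c e) (x :: A).
    rewrite -ctAB -szAB has_count /= cx; lia.
  by exists y.
have By' := perm_to_rem By.
have [||R RA RB] := IH (rem y B).
- by have := perm_size By'; rewrite -szAB /= => -[].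
- by have := permP By' (c e); rewrite -ctAB /= xy => /addnI.
have [z zx zy] := glue _ _ xy.
exists (z :: R) => /=; first by rewrite RA; congr (_ :: _); apply/eqP/keyP.
rewrite perm_sym (permPl (perm_map _ By')) /= perm_sym.
by have /eqP-> : key (e |: F2) z == key (e |: F2) y; rewrite ?perm_cons; first apply/keyP.
Qed.

(** In a fibre product the way in which the left halves of the states are matched
    with the right halves is irrelevant: exchanging the right halves of two
    states with the same value at e is a move.  One therefore only has to keep
    track of the multiset of left halves and the multiset of right halves. *)
Lemma fiber_conn_matching F1 F2 e S T : glues F1 F2 e ->
  perm_eq (map (key (e |: F1)) S) (map (key (e |: F1)) T) ->
  perm_eq (map (key (e |: F2)) S) (map (key (e |: F2)) T) ->
  fiber_conn (e |: (F1 :|: F2)) S T.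
Proof.
move=> glue; elim: T S => [|t T IH] S S1 S2.
  by have := perm_size S1; case: S {S1 S2} => // _; apply: fiber_conn_refl.
have inF z : {in e |: F1, c ^~ z =1 c ^~ t} -> {in e |: F2, c ^~ z =1 c ^~ t} ->
    {in e |: (F1 :|: F2), c ^~ z =1 c ^~ t}.
  move=> z1 z2 p /setU1P[->|/setUP[pF|pF]].
  - by apply: z1; rewrite setU11.
  - by apply: z1; rewrite setU1r.
  - by apply: z2; rewrite setU1r.
have /mapP[s Ss /esym/eqP/keyP st] : key (e |: F1) t \in map (key (e |: F1)) S.
  by rewrite (perm_mem S1) mem_head.
have Ss' := perm_to_rem Ss; set S' := rem s S in Ss'.
have /mapP[s' Ss1 /esym/eqP/keyP st'] : key (e |: F2) t \in map (key (e |: F2)) S.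
  by rewrite (perm_mem S2) mem_head.
apply: (Fiber_trans (Fiber_perm _ Ss')).
rewrite (permPl (perm_map _ Ss')) /= in S1; rewrite (permPl (perm_map _ Ss')) /= in S2.
move: Ss1; rewrite (perm_mem Ss') inE => /predU1P[ss'|S's'].
  subst s'; apply: (@Fiber_trans _ _ (t :: S')); first exact/fiber_conn1/inF.
  apply/fiber_conn_cons/IH.
    by rewrite -(perm_cons (key (e |: F1) s)) (permPl S1) (eqP (introT (keyP _ _ _) st)).
  by rewrite -(perm_cons (key (e |: F2) s)) (permPl S2) (eqP (introT (keyP _ _ _) st')).
have S's := perm_to_rem S's'; set R := rem s' S' in S's.
apply: (@Fiber_trans _ _ ([:: s; s'] ++ R)).
  by apply: Fiber_perm; rewrite /= perm_cons.
have pR F : perm_eq (key F s :: map (key F) S') (key F s :: key F s' :: map (key F) R).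
  by rewrite perm_cons (permPl (perm_map _ S's)).
rewrite (permPl (pR _)) in S1; rewrite (permPl (pR _)) in S2.
have [|g gs' gs] := glue s' s.
  by rewrite st ?setU11 // st' ?setU11.
apply: (@Fiber_trans _ _ ([:: t; g] ++ R)).
  apply: Fiber_move => //; split=> // p /=.
  case/setU1P=> [->|/setUP[pF|pF]].
  - by rewrite st ?setU11 // gs' ?setU11.
  - by rewrite st ?setU1r // gs' ?setU1r.
  - by rewrite -(st' p) ?setU1r // gs ?setU1r // addnCA.
apply/fiber_conn_cons/IH => /=.
  rewrite -(perm_cons (key (e |: F1) t)) -(permPr S1) /=.
  have /eqP-> : key (e |: F1) g == key (e |: F1) s' by apply/keyP.
  by have /eqP-> : key (e |: F1) s == key (e |: F1) t by apply/keyP.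
rewrite -(perm_cons (key (e |: F2) t)) -(permPr S2) /=.
have /eqP-> : key (e |: F2) g == key (e |: F2) s by apply/keyP.
have /eqP-> : key (e |: F2) s' == key (e |: F2) t by apply/keyP.
exact: permEl (perm_catCA [:: _] [:: _] _).
Qed.

(** A move of the left network preserves the number of states with c e, so the
    right halves can be redistributed over the new left halves. *)
Lemma lift_fiber_conn F1 F2 e S S' R : glues F1 F2 e ->
  fiber_conn (e |: F1) S S' ->
  perm_eq (map (key (e |: F1)) R) (map (key (e |: F1)) S) ->
  exists R', [/\ fiber_conn (e |: (F1 :|: F2)) R R',
     perm_eq (map (key (e |: F1)) R') (map (key (e |: F1)) S')
   & perm_eq (map (key (e |: F2)) R') (map (key (e |: F2)) R)].
Proof.
move=> glue; move=> SS'; elim: SS' R => {S S'} [S S' SS'|A B Q sA AB|S1 S2 S3 _ IH1 _ IH2]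
  R RS.
- exists R; split=> //; first exact: fiber_conn_refl.
  by rewrite (permPl RS) perm_map.
- rewrite map_cat in RS; have [RA [RQ [RAQ fRA fRQ]]] := perm_map_split RS.
  have RAA : agree (e |: F1) RA A by apply: agree_key; rewrite fRA.
  have [||RB RB1 RB2] := @realize_keys F1 F2 e B RA glue.
  - by case: AB => <- _; case: RAA.
  - by case: AB => _ <-; rewrite ?setU11 //; case: RAA => _ ->; rewrite ?setU11.
  exists (RB ++ RQ); split.
  + apply: (Fiber_trans (Fiber_perm _ RAQ)); apply: Fiber_move.
      by case: RAA => ->.
    have a1 : agree (e |: F1) RA RB.
      apply: agree_trans RAA (agree_trans AB _).
      by apply: agree_sym; apply: agree_key; rewrite RB1.
    have a2 := agree_sym (agree_key RB2).
    by rewrite setUUr; apply: agreeU.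
  + by rewrite !map_cat RB1 fRQ.
  + by rewrite (permPr (perm_map _ RAQ)) !map_cat perm_cat2r.
- have [R1 [c1 r1 p1]] := IH1 R RS; have [R2 [c2 r2 p2]] := IH2 R1 r1.
  exists R2; split=> //; first exact: Fiber_trans c2.
  by rewrite (permPl p2).
Qed.

Lemma fibers_connected_glue F1 F2 e : glues F1 F2 e ->
  fibers_connected (e |: F1) -> fibers_connected (e |: F2) -> fibers_connected (e |: (F1
    :|: F2)).
Proof.
move=> glue q1 q2 S T ST.
have ST1 : fiber_conn (e |: F1) S T by apply/q1/(agreeS _ ST); rewrite setUS ?subsetUl.
have [R [SR RT RS]] := lift_fiber_conn (R := S) glue ST1 (perm_refl _).
have RT2 : fiber_conn (e |: F2) R T.
  by apply: q2; apply: agree_trans (agree_key RS) (agreeS _ ST); rewrite setUS ?subsetUr.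
have [R' [RR' R'T R'R]] := lift_fiber_conn (R := R) (glues_sym glue) RT2 (perm_refl _).
rewrite setUC (setUC F2) in RR'.
apply: (Fiber_trans SR); rewrite setUC; apply: (Fiber_trans RR'); rewrite setUC.
by apply: (fiber_conn_matching glue) => //; rewrite (permPl R'R).
Qed.

(** Two states singled out on the left and two singled out on the right can be
    put into the same two positions, provided that they agree at e. *)
Lemma align_pairs F1 F2 e S x y A z t B : glues F1 F2 e ->
  fiber_conn (e |: F1) S (x :: y :: A) -> fiber_conn (e |: F2) S (z :: t :: B) ->
  c e x = c e z -> c e y = c e t ->
  exists g h C, [/\ fiber_conn (e |: (F1 :|: F2)) S (g :: h :: C),
    {in e |: F1, c ^~ g =1 c ^~ x}, {in e |: F1, c ^~ h =1 c ^~ y},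
    {in e |: F2, c ^~ g =1 c ^~ z} & {in e |: F2, c ^~ h =1 c ^~ t}].
Proof.
move=> glue S1 S2 xz yt.
have [R [SR RT RS]] := lift_fiber_conn (R := S) glue S1 (perm_refl _).
have [R' [RR' R'T R'R]] := lift_fiber_conn (R := R) (glues_sym glue) S2 RS.
have [||C CA CB] := @realize_keys F1 F2 e A B glue.
- by have [+ _] := fiber_conn_agree S1; have [-> _] := fiber_conn_agree S2 => -[].
- have [_ /(_ e (setU11 _ _)) /=] := fiber_conn_agree S1.
  have [_ /(_ e (setU11 _ _)) /=] := fiber_conn_agree S2.
  by rewrite xz yt => -> /eqP; rewrite !eqn_add2l => /eqP->.
have [g gx gz] := glue _ _ xz; have [h hy ht] := glue _ _ yt.
exists g, h, C; split=> //; apply: (Fiber_trans SR).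
rewrite (setUC F1); apply: (Fiber_trans RR'); rewrite (setUC F2).
apply: (fiber_conn_matching glue).
  rewrite (permPl R'R) (permPl RT) /= CA.
  have /eqP-> : key (e |: F1) g == key (e |: F1) x by apply/keyP.
  by have /eqP-> : key (e |: F1) h == key (e |: F1) y by apply/keyP.
rewrite (permPl R'T) /=.
have /eqP-> : key (e |: F2) g == key (e |: F2) z by apply/keyP.
have /eqP-> : key (e |: F2) h == key (e |: F2) t by apply/keyP.
by rewrite !perm_cons perm_sym.
Qed.

(** The means to delete the coordinate e: when S has an excess of at least two
    states with value b at e, moves that still respect e lead to a multiset in
    which two such states can be exchanged for two states with the opposite
    value.  The pair is exhibited, instead of only the smaller multiset, so that
    exchanges of different networks can be performed simultaneously. *)
Definition reducible b F e := forall S T, agree F S T ->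
  count (fun x => c e x == b) T + 2 <= count (fun x => c e x == b) S ->
  exists x y A x' y', [/\ fiber_conn (e |: F) S (x :: y :: A),
    c e x = b, c e y = b, c e x' = ~~ b & c e y' = ~~ b] /\
    agree F [:: x; y] [:: x'; y'].

(** In a network that connects the ends of e, a cut separates them if and only if
    it cuts a path between them an odd number of times. *)
Definition parity F e := forall S T, agree F S T ->
  odd (count (c e) S) = odd (count (c e) T).

Lemma count_eqb b e S :
  count (fun x => c e x == b) S = if b then count (c e) S else size S - count (c e) S.
Proof.
case: b; first by apply: eq_count => x; rewrite eqb_id.
rewrite -(count_predC (c e) S) addKn; apply: eq_count => x /=.
by case: (c e x).
Qed.

Lemma parityS F F' e : F \subset F' -> parity F e -> parity F' e.
Proof. by move=> sF pF S T /(agreeS sF); apply: pF. Qed.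

Lemma agree_equiv F F' :
  {in F', forall p, exists2 q, q \in F & c p =1 c q} ->
  forall S T, agree F S T -> agree F' S T.
Proof.
move=> FF' S T [sz ct]; split=> // p /FF'[q qF pq].
by rewrite !(eq_count pq) ct.
Qed.

Lemma fiber_conn_equiv F F' S T :
  (forall A B, agree F A B -> agree F' A B) -> fiber_conn F S T -> fiber_conn F' S T.
Proof.
move=> FF'; elim=> [{}S {}T|A B R sA /FF' AB|S1 T1 R _ + _ ].
- exact: Fiber_perm.
- exact: Fiber_move.
- exact: Fiber_trans.
Qed.

Lemma fibers_connected_equiv F F' :
  (forall A B, agree F A B <-> agree F' A B) -> fibers_connected F -> fibers_connected F'.
Proof.
move=> FF' q S T /FF'/q; apply: fiber_conn_equiv => A B; exact: (FF' A B).1.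
Qed.

Lemma reduce_step b F e S T : agree F S T -> reducible b F e ->
  count (fun x => c e x == b) T + 2 <= count (fun x => c e x == b) S ->
  exists2 S', fiber_conn F S S' &
    (count (fun x => c e x == b) S' + 2 = count (fun x => c e x == b) S)%N.
Proof.
move=> ST red lt; have [x [y [A [x' [y' [[SA xb yb xb' yb'] ag]]]]]] := red S T ST lt.
exists (x' :: y' :: A).
  apply: Fiber_trans (fiber_connS (subsetUr _ _) SA) _.
  exact: (@Fiber_move _ [:: x; y] [:: x'; y']).
have [sz /(_ e (setU11 _ _)) ct] := fiber_conn_agree SA.
rewrite !count_eqb sz ct /= xb yb xb' yb' {xb yb xb' yb'}.
have := count_size (c e) A.
by case: b {red lt} => /=; lia.
Qed.

(** Reductions of the larger of the two counts at e lead to equal counts, because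
    the counts have the same parity. *)
Lemma fibers_connected_delete F e :
  fibers_connected (e |: F) -> reducible true F e -> parity F e -> fibers_connected F.
Proof.
move=> q red par.
pose n S := count (fun x => c e x == true) S.
have main k : forall S T, agree F S T -> n T <= n S -> n S - n T <= k -> fiber_conn F S T.
  elim/ltn_ind: k => k IH S T ST le lek.
  case: (eqVneq (n S) (n T)) => [nST|neq].
    apply: (fiber_connS (subsetUr [set e] F)); apply: q; apply: agreeU1 => //.
    by move: nST; rewrite /n !count_eqb.
  have gap : n T + 2 <= n S.
    have := par S T ST; move: neq le; rewrite /n !count_eqb; lia.
  have [S' SS' nS'] := reduce_step ST red gap.
  apply: (Fiber_trans SS'); apply: (IH (k - 2)); rewrite -/(n S') -/(n S) in nS' *; try lia.
  exact: agree_trans (agree_sym (fiber_conn_agree SS')) ST.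
move=> S T ST; case/orP: (leq_total (n T) (n S)) => le; first exact: (main (n S - n T)).
by apply/fiber_conn_sym/(main (n T - n S)) => //; apply: agree_sym.
Qed.

(** Run the reductions backwards: T is lowered until one step before its count
    reaches that of S, and then this last step read from right to left is an
    exchange that raises a multiset connected with S. *)
Lemma reducible_false F e :
  fibers_connected (e |: F) -> reducible true F e -> parity F e -> reducible false F e.
Proof.
move=> q red par S T ST; have [sz _] := ST.
rewrite !count_eqb sz => gap.
have {}gap : count (c e) S + 2 <= count (c e) T.
  by have := count_size (c e) T; have := count_size (c e) S; rewrite sz; lia.
have [k] := ubnP (count (c e) T); elim: k T ST sz gap => // k IH T ST sz gap /ltnSE lek.
have [||x [y [A [x' [y' [[TA xb yb xb' yb'] ag]]]]]] := red T S.
- exact: agree_sym.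
- by rewrite !count_eqb.
set T' := x' :: y' :: A.
have TT' : agree F T T'.
  apply: agree_trans (agreeS (subsetUr _ _) (fiber_conn_agree TA)) _.
  by apply: (agree_cat (S := [:: x; y]) (T := [:: x'; y']) _ (agree_refl _ _)).
have nT' : count (c e) T' + 2 = count (c e) T.
  have [_ /(_ e (setU11 _ _)) ->] := fiber_conn_agree TA.
  by rewrite /= xb yb xb' yb' /=; lia.
have ST' := agree_trans ST TT'.
case: (eqVneq (count (c e) S) (count (c e) T')) => [eqn|neq].
  exists x', y', A, x, y; rewrite xb yb xb' yb'; split; last exact: agree_sym.
  by split=> //; apply: q; apply: agreeU1.
apply: (IH T') => //; [by case: ST' | | lia].
have := par S T' ST'; move: neq; lia.
Qed.

(** The exchanges of the two networks have to happen at the same two states. *)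
Lemma reducible_glue b F1 F2 e : glues F1 F2 e ->
  reducible b F1 e -> reducible b F2 e -> reducible b (F1 :|: F2) e.
Proof.
move=> glue r1 r2 S T ST lt.
have [x [y [A [x' [y' [[SA xb yb xb' yb'] ag]]]]]] := r1 S T (agreeS (subsetUl _ _) ST) lt.
have [z [t [B [z' [t' [[SB zb tb zb' tb'] ah]]]]]] := r2 S T (agreeS (subsetUr _ _) ST) lt.
have [||g [h [C [SC gx hy gz ht]]]] := align_pairs glue SA SB; rewrite ?zb ?tb //.
have [g' gx' gz'] := glue x' z' (etrans xb' (esym zb')).
have [h' hy' ht'] := glue y' t' (etrans yb' (esym tb')).
exists g, h, C, g', h'; split; first by split; rewrite // (gx, hy, gx', hy') ?setU11.
split=> // p /setUP[] pF /=.
- by rewrite gx ?hy ?gx' ?hy' ?setU1r //; have [_ /(_ p pF)] := ag.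
- by rewrite gz ?ht ?gz' ?ht' ?setU1r //; have [_ /(_ p pF)] := ah.
Qed.

Lemma reducible1 e e' F : e' \in F -> c e =1 c e' -> reducible true F e.
Proof.
move=> eF ee' S T [sz ct]; rewrite !count_eqb (eq_count ee') (eq_count ee' S) ct //; lia.
Qed.

Lemma count2_split (P : pred X) S : 2 <= count P S ->
  exists x y A, [/\ perm_eq S (x :: y :: A), P x & P y].
Proof.
move=> ge2; have /hasP[x Sx Px] : has P S by rewrite has_count; lia.
have Sx' := perm_to_rem Sx; have := permP Sx' P; rewrite /= Px => ct.
have /hasP[y Sy Py] : has P (rem x S) by rewrite has_count; lia.
exists x, y, (rem y (rem x S)); split=> //.
by rewrite (permPl Sx') perm_cons perm_to_rem.
Qed.

(** Two networks that share only one vertex: states can be combined freely. *)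
Definition joins F1 e1 F2 e2 := forall x y, exists2 z,
  {in e1 |: F1, c ^~ z =1 c ^~ x} & {in e2 |: F2, c ^~ z =1 c ^~ y}.

Lemma joins_sym F1 e1 F2 e2 : joins F1 e1 F2 e2 -> joins F2 e2 F1 e1.
Proof. by move=> j x y; have [z zy zx] := j y x; exists z. Qed.

(** The three edges e, e1, e2 of a triangle. *)
Definition closes e e1 e2 := forall x, c e x = c e1 x (+) c e2 x.

Lemma closes_sym e e1 e2 : closes e e1 e2 -> closes e e2 e1.
Proof. by move=> cl x; rewrite cl addbC. Qed.

Lemma parity_series F1 F2 e e1 e2 : closes e e1 e2 ->
  parity F1 e1 -> parity F2 e2 -> parity (F1 :|: F2) e.
Proof.
move=> cl p1 p2 S T ST.
have oddD U : odd (count (c e) U) = odd (count (c e1) U) (+) odd (count (c e2) U).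
  elim: U => //= x U IH; rewrite !oddD IH cl !oddb.
  by case: (c e1 x) (c e2 x) (odd _) (odd _) => [] [] [] [].
rewrite !oddD (p1 S T) ?(p2 S T) //; apply: agreeS ST; rewrite ?subsetUl ?subsetUr //.
Qed.

Lemma glues_series F1 F2 e e1 e2 : closes e e1 e2 -> joins F1 e1 F2 e2 ->
  glues F1 (e2 |: (e |: F2)) e1.
Proof.
move=> cl jo x y xy; have [z zx zy] := jo x y; exists z => // p.
case/setU1P=> [->|/setU1P[->|/setU1P[->|pF]]].
- by rewrite zx ?setU11.
- by rewrite zy ?setU11.
- by rewrite !cl zx ?setU11 // zy ?setU11 // xy.
- by rewrite zy ?setU1r.
Qed.

(** In a series composition a state that cuts e cuts exactly one of e1 and e2.
    Suppose that in S it is always e1.  Then n(e) = n(e1) - n(e2) in S, whereas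
    n(e) >= n(e1) - n(e2) in T.  So S has either too many states cutting e1, and
    a reduction of the first network applied to two states cutting e1 only makes
    them cut neither; or too few cutting e2, and raising e2 in the second network
    makes them cut both.  In each case e is no longer cut. *)
Lemma reducible_series_half F1 F2 e e1 e2 S T :
  closes e e1 e2 -> joins F1 e1 F2 e2 ->
  fibers_connected (e1 |: F1) -> reducible true F1 e1 -> parity F1 e1 ->
  fibers_connected (e2 |: F2) -> reducible true F2 e2 -> parity F2 e2 ->
  agree (F1 :|: F2) S T -> count (c e) T + 2 <= count (c e) S ->
  {in S, forall x, c e x -> c e1 x} ->
  exists x y A x' y', [/\ fiber_conn (e |: (F1 :|: F2)) S (x :: y :: A),
    c e x = true, c e y = true, c e x' = false & c e y' = false] /\
    agree (F1 :|: F2) [:: x; y] [:: x'; y'].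
Proof.
move=> cl jo q1 r1 p1 q2 r2 p2 ST lt type10.
have ST1 := agreeS (subsetUl _ _) ST; have ST2 := agreeS (subsetUr _ _) ST.
have ctS : count (c e1) S = count (c e2) S + count (c e) S.
  elim: S type10 {lt ST ST1 ST2} => //= x S IH xS.
  rewrite IH; last by move=> z zS; apply: xS; rewrite inE zS orbT.
  by have := xS x (mem_head _ _); rewrite cl; case: (c e1 x) (c e2 x) => [] []; lia.
have ctT : count (c e1) T <= count (c e2) T + count (c e) T.
  elim: T {lt ST ST1 ST2} => //= x T IH.
  by rewrite cl; case: (c e1 x) (c e2 x) => [] [] /=; lia.
have [z [t [B [SB ze te]]]] : exists z t B, [/\ perm_eq S (z :: t :: B), c e z & c e t].
  by apply: count2_split; lia.
have z1 : c e1 z by apply: type10; rewrite ?(perm_mem SB) ?mem_head.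
have t1 : c e1 t by apply: type10; rewrite ?(perm_mem SB) // inE mem_head orbT.
have z2 : c e2 z = false by move: ze; rewrite cl z1; case: (c e2 z).
have t2 : c e2 t = false by move: te; rewrite cl t1; case: (c e2 t).
have par1 := p1 _ _ ST1; have par2 := p2 _ _ ST2.
(* z and t are two states of S that cut e and e1, but not e2. *)
case: (ltnP (count (c e1) T) (count (c e1) S)) => [lt1|ge1].
  have [|x [y [A [x' [y' [[SA xb yb xb' yb'] ag]]]]]] := r1 S T ST1.
    by rewrite !count_eqb; move: par1 lt1; lia.
  have [||g [h [C [SC gx hy gz ht]]]] :=
    align_pairs (glues_series cl jo) SA (Fiber_perm _ SB); rewrite ?z1 ?t1 //.
  have [g' gx' gz'] := jo x' z; have [h' hy' ht'] := jo y' t.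
  exists g, h, C, g', h'; split.
    split.
    - by apply: fiber_connS SC; apply/subsetP=> p; rewrite !inE => /or3P[] ->; rewrite ?orbT.
    - by rewrite gz ?ze // !inE eqxx !orbT.
    - by rewrite ht ?te // !inE eqxx !orbT.
    - by rewrite cl gx' ?gz' ?setU11 // xb' z2.
    - by rewrite cl hy' ?ht' ?setU11 // yb' t2.
  split=> // p /setUP[] pF /=.
  - by rewrite gx ?hy ?gx' ?hy' ?setU1r //; have [_ /(_ p pF)] := ag.
  - by rewrite gz ?ht ?gz' ?ht' // !inE pF !orbT.
have [|x [y [A [x' [y' [[SA xb yb xb' yb'] ag]]]]]] := reducible_false q2 r2 p2 ST2.
  have [sz _] := ST; rewrite !count_eqb sz.
  by have := count_size (c e2) T; move: par2 ge1; lia.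
have [||g [h [C [SC gx hy gz ht]]]] :=
  align_pairs (glues_series (closes_sym cl) (joins_sym jo)) SA (Fiber_perm _ SB); rewrite
    ?z2 ?t2 //.
have [g' gx' gz'] := jo z x'; have [h' hy' ht'] := jo t y'.
exists g, h, C, g', h'; split.
  split.
  - by apply: fiber_connS SC; apply/subsetP=> p; rewrite !inE => /or3P[] ->; rewrite ?orbT.
  - by rewrite gz ?ze // !inE eqxx !orbT.
  - by rewrite ht ?te // !inE eqxx !orbT.
  - by rewrite cl gx' ?gz' ?setU11 // xb' z1.
  - by rewrite cl hy' ?ht' ?setU11 // yb' t1.
split=> // p /setUP[] pF /=.
- by rewrite gz ?ht ?gx' ?hy' // !inE pF ?orbT.
- by rewrite gx ?hy ?gz' ?ht' ?setU1r //; have [_ /(_ p pF)] := ag.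
Qed.

(** If some state of S cuts e1 and e and another one cuts e2 and e, exchanging
    their halves produces a state cutting both e1 and e2 and one cutting
    neither. *)
Lemma reducible_series F1 F2 e e1 e2 :
  closes e e1 e2 -> joins F1 e1 F2 e2 ->
  fibers_connected (e1 |: F1) -> reducible true F1 e1 -> parity F1 e1 ->
  fibers_connected (e2 |: F2) -> reducible true F2 e2 -> parity F2 e2 ->
  reducible true (F1 :|: F2) e.
Proof.
move=> cl jo q1 r1 p1 q2 r2 p2 S T ST; rewrite !count_eqb => lt.
case: (boolP (all (fun x => c e x ==> c e1 x) S)) => [/allP h1|].
  apply: (reducible_series_half cl jo q1 r1 p1 q2 r2 p2 ST lt).
  by move=> x /h1 /implyP.
case/allPn=> x Sx; rewrite negb_imply => /andP[xe /negbTE x1].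
case: (boolP (all (fun x => c e x ==> c e2 x) S)) => [/allP h2|].
  rewrite setUC in ST *.
  apply: (reducible_series_half (closes_sym cl) (joins_sym jo) q2 r2 p2 q1 r1 p1 ST lt).
  by move=> y /h2 /implyP.
case/allPn=> y Sy; rewrite negb_imply => /andP[ye /negbTE y2].
have x2 : c e2 x by move: xe; rewrite cl x1.
have y1 : c e1 y by move: ye; rewrite cl y2; case: (c e1 y).
have Sx' := perm_to_rem Sx.
have Sy' : y \in rem x S.
  have : y \in x :: rem x S by rewrite -(perm_mem Sx').
  by rewrite inE => /predU1P[yx|//]; rewrite yx x1 in y1.
have [g gx gy] := jo x y; have [h hy hx] := jo y x.
exists x, y, (rem y (rem x S)), g, h; split.
  split=> //.
  - by apply: Fiber_perm; rewrite (permPl Sx') perm_cons perm_to_rem.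
  - by rewrite cl gx ?gy ?setU11 // x1 y2.
  - by rewrite cl hy ?hx ?setU11 // y1 x2.
split=> // p /setUP[] pF /=; first by rewrite gx ?hy ?setU1r.
by rewrite gy ?hx ?setU1r // addnCA.
Qed.

Lemma gluesS F1 F2 F1' F2' e : F1' \subset F1 -> F2' \subset F2 ->
  glues F1 F2 e -> glues F1' F2' e.
Proof.
move=> /(setUS [set e])/subsetP s1 /(setUS [set e])/subsetP s2 g x y /g[z zx zy].
by exists z => p pF; [apply/zx/s1 | apply/zy/s2].
Qed.

(** Multisets with the same types are connected by exchanging one state at a
    time. *)
Lemma fiber_conn_types (K : eqType) (f : X -> K) F S T :
  (forall x y, f x = f y -> {in F, c ^~ x =1 c ^~ y}) ->
  perm_eq (map f S) (map f T) -> fiber_conn F S T.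
Proof.
move=> fF; rewrite -[map f T]cats0 => /perm_map_split[S1 [S2 [SS1 fS1]]].
case: S2 SS1 => // SS1 _; rewrite cats0 in SS1; apply: (Fiber_trans (Fiber_perm _ SS1)).
elim: S1 T fS1 {S SS1} => [|x S1 IH] [|y T] //=; first by move=> _; exact: fiber_conn_refl.
case=> xy fST.
apply: (@Fiber_trans _ _ (y :: S1)); first exact/fiber_conn1/fF.
exact/fiber_conn_cons/IH.
Qed.

Lemma fibers_connected1 e : fibers_connected [set e].
Proof.
move=> S T [sz /(_ e (set11 _)) ct]; apply: (@fiber_conn_types _ (c e)).
  by move=> x y xy p /set1P->.
have cnt U : count (c e) U = count_mem true (map (c e) U).
  by rewrite count_map; apply: eq_count => x /=; rewrite eqb_id.
have cntF U : size U = count_mem true (map (c e) U) + count_mem false (map (c e) U).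
  by rewrite !count_map -(count_predC (c e)); congr (_ + _); apply: eq_count => x /=;
    case: (c e x).
have := cntF S; have := cntF T; rewrite -!cnt sz ct => sT sS.
by apply/allP => -[] _; apply/eqP; rewrite /= -?cnt //; apply/(@addnI (count (c e) T));
  rewrite -sT -sS.
Qed.

Lemma parity1 e : parity [set e] e.
Proof. by move=> S T [_ /(_ e (set11 _)) ->]. Qed.

(** A cut of the triangle is determined by its values at e1 and e2, and the
    numbers of cuts of the four types by the size and the three counts. *)
Lemma fibers_connected_triangle e e1 e2 : closes e e1 e2 -> fibers_connected (e1 |: [set
  e2; e]).
Proof.
move=> cl S T [sz ct]; pose f x := (c e1 x, c e2 x).
apply: (@fiber_conn_types _ f).
  by move=> x y [x1 x2] p; rewrite !inE => /or3P[] /eqP->; rewrite ?cl ?x1 ?x2.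
have ct1 := ct e1 (setU11 _ _).
have ct2 : count (c e2) S = count (c e2) T by apply: ct; rewrite !inE eqxx orbT.
have ct3 : count (c e) S = count (c e) T by apply: ct; rewrite !inE eqxx !orbT.
pose n U a b := count_mem (a, b) (map f U).
have cnt U : [/\ size U = n U true true + n U true false + (n U false true + n U false false),
   count (c e1) U = n U true true + n U true false,
   count (c e2) U = n U true true + n U false true &
   count (c e) U = n U true false + n U false true].
  rewrite /n; elim: U => //= x U [-> -> -> ->]; rewrite cl /f.
  by case: (c e1 x) (c e2 x) => [] [] /=; split; lia.
suffices eqn a b : n S a b = n T a b by apply/allP=> -[a b] _; apply/eqP/eqn.
have [sS S1 S2 S3] := cnt S; have [sT T1 T2 T3] := cnt T.
by case: a b => [] []; lia.
Qed.

(** Both networks are glued to the triangle e, e1, e2, and the edges e1 and e2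
    are then deleted one after the other.  When e2 is deleted, the other network
    along it is the series composition of the first network and e. *)
Lemma fibers_connected_series F1 F2 e e1 e2 :
  closes e e1 e2 -> joins F1 e1 F2 e2 ->
  joins F1 e1 [set e] e -> joins [set e2] e2 [set e] e ->
  fibers_connected (e1 |: F1) -> reducible true F1 e1 -> parity F1 e1 ->
  fibers_connected (e2 |: F2) -> reducible true F2 e2 -> parity F2 e2 ->
  fibers_connected (e |: (F1 :|: F2)).
Proof.
move=> cl jo jo1 jo2 q1 r1 p1 q2 r2 p2.
have cl1 : closes e1 e2 e by move=> x; rewrite cl; case: (c e1 x) (c e2 x) => [] [].
have cl2 : closes e2 e1 e by move=> x; rewrite cl; case: (c e1 x) (c e2 x) => [] [].
have red1 p : reducible true [set p] p by apply: reducible1 (set11 _) _.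
have g1 : glues F1 [set e2; e] e1.
  by apply: gluesS (glues_series cl jo); rewrite ?subxx // !setUA subsetUl.
have r2e : reducible true [set e2; e] e1.
  by apply: (reducible_series cl1 jo2); rewrite ?setUid //;
    first [exact: fibers_connected1 | exact: parity1].
(* The first network, with e2 and e closing the triangle over e1. *)
have s1 := fibers_connected_glue g1 q1 (fibers_connected_triangle cl).
have s2 : fibers_connected (F1 :|: [set e2; e]).
  apply: fibers_connected_delete s1 (reducible_glue g1 r1 r2e) (parityS (subsetUl _ _) p1).
have g2 : glues (F1 :|: [set e]) F2 e2.
  apply/glues_sym; apply: gluesS (glues_series (closes_sym cl) (joins_sym jo)).
    exact: subxx.
  by apply/subsetP=> p; rewrite !inE => /orP[] ->; rewrite ?orbT.
have re : reducible true (F1 :|: [set e]) e2.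
  by apply: (reducible_series cl2 jo1) => //; rewrite ?setUid;
    first [exact: fibers_connected1 | exact: parity1].
(* The second network, glued along e2 to the first one and e. *)
have s3 : fibers_connected (e2 |: (F1 :|: [set e] :|: F2)).
  by apply: fibers_connected_glue g2 _ q2; rewrite setUCA.
have := fibers_connected_delete s3 (reducible_glue g2 re r2) (parityS (subsetUr _ _) p2).
by rewrite -setUA setUCA.
Qed.

End Fibers.

(** * Connected sets, and separating vertices in graphs without K4 minor *)

Section Connectivity.
Import mathcomp.boot.fintype mathcomp.boot.finset.
Variables (V : finType) (e : rel V).
Hypothesis e_sym : ssrbool.symmetric e.
Implicit Types (A B C D K : {set V}) (u v w x y z : V).

Definition link A := connect [rel u v | [&& e u v, u \in A & v \in A]].

Lemma link_sym A x y : link A x y = link A y x.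
Proof.
by apply: sym_connect_sym => u v /=; rewrite e_sym [(u \in A) && _]andbC.
Qed.

Lemma linkS A B x y : A \subset B -> link A x y -> link B x y.
Proof.
move=> /subsetP sAB; apply: connect_sub => u v /and3P[uv uA vA].
by apply: connect1; rewrite /= uv !sAB.
Qed.

Lemma link1 A x y : e x y -> x \in A -> y \in A -> link A x y.
Proof. by move=> xy xA yA; apply: connect1; rewrite /= xy xA. Qed.

Lemma link_exit A D x y : link A x y -> x \in D -> y \notin D ->
  exists a b, [/\ e a b, a \in A, b \in A, a \in D & b \notin D].
Proof.
move=> /connectP[p pth ->]; elim: p x pth => [|z p IH] x /=; first by move=> _ ->.
case/andP=> /and3P[xz xA zA] pth xD; case: (boolP (z \in D)) => zD; first exact: IH.
by exists x, z.
Qed.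

Lemma connected_hub A x : x \in A -> {in A, forall y, link A x y} -> connected_in e A.
Proof.
move=> xA hub; split; first by apply/set0Pn; exists x.
by move=> y z yA zA; apply: connect_trans (hub z zA); rewrite -/(link A y x) link_sym hub.
Qed.

Lemma connected_link A x y : connected_in e A -> x \in A -> y \in A -> link A x y.
Proof. by case=> _; apply. Qed.

Lemma connected1 x : connected_in e [set x].
Proof. by apply: (@connected_hub _ x); rewrite ?set11 // => y /set1P->; apply: connect0. Qed.

Lemma connected_exit A D x y : connected_in e A ->
  x \in A -> y \in A -> x \in D -> y \notin D ->
  exists a b, [/\ e a b, a \in A, b \in A, a \in D & b \notin D].
Proof. by move=> cA xA yA; apply: link_exit (connected_link cA xA yA). Qed.

Lemma connectedUI A B x : connected_in e A -> connected_in e B ->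
  x \in A -> x \in B -> connected_in e (A :|: B).
Proof.
move=> cA cB xA xB; apply: (@connected_hub _ x); first by rewrite inE xA.
move=> y /setUP[yA|yB].
  by apply: linkS (connected_link cA xA yA); apply: subsetUl.
by apply: linkS (connected_link cB xB yB); apply: subsetUr.
Qed.

Lemma connected2 x y : e x y -> connected_in e [set x; y].
Proof.
move=> xy; apply: (@connected_hub _ x); first by rewrite !inE eqxx.
move=> z /set2P[] ->; first exact: connect0.
by apply: link1; rewrite ?inE ?eqxx ?orbT.
Qed.

Lemma connectedUe A B x y : connected_in e A -> connected_in e B ->
  x \in A -> y \in B -> e x y -> connected_in e (A :|: B).
Proof.
move=> cA cB xA yB xy.
have -> : A :|: B = A :|: [set x; y] :|: B.
  apply/setP=> z; rewrite !inE; case: (eqVneq z x) => [->|_]; rewrite ?xA //=.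
  by case: (eqVneq z y) => [->|_]; rewrite ?yB ?orbT ?orbF.
apply: (connectedUI _ cB (_ : y \in _) yB); last by rewrite !inE eqxx !orbT.
exact: connectedUI cA (connected2 xy) xA (set21 _ _).
Qed.

Definition comp A x := [set y in A | link A x y].

Lemma comp_sub A x : comp A x \subset A.
Proof. by apply/subsetP=> y; rewrite inE => /andP[]. Qed.

Lemma comp_mem A x : x \in A -> x \in comp A x.
Proof. by move=> xA; rewrite inE xA; apply: connect0. Qed.

Lemma comp_closed A x y z : y \in comp A x -> z \in A -> e y z -> z \in comp A x.
Proof.
rewrite !inE => /andP[yA xy] zA yz; rewrite zA /=.
by apply: connect_trans xy _; apply: link1.
Qed.

Lemma comp_connected A x : x \in A -> connected_in e (comp A x).
Proof.
move=> xA; apply: (@connected_hub _ x); first exact: comp_mem.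
move=> y /[dup] yC; rewrite inE => /andP[yA xy].
apply/negP=> /negP nxy.
have [||a [b [ab aA bA]]] := @link_exit A [set z in comp A x | link (comp A x) x z] x y xy.
- by rewrite inE comp_mem //; apply: connect0.
- by rewrite inE yC.
rewrite !inE -!andbA aA bA => /and3P[_ xa xa']; rewrite (_ : link A x b); last first.
  by apply: connect_trans (link1 ab aA bA).
rewrite (_ : link (comp A x) x b) //; apply: connect_trans xa' _.
apply: link1 => //; rewrite inE ?aA //= bA.
by apply: connect_trans (link1 ab aA bA).
Qed.

Lemma connected_sub_comp A K x : connected_in e K -> K \subset A -> x \in K ->
  K \subset comp A x.
Proof.
move=> cK sKA xK; apply/subsetP=> y yK; rewrite inE (subsetP sKA) //=.
exact: linkS sKA (connected_link cK xK yK).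
Qed.

(** All components of [C :\ y] are attached to y, so that removing one of them
    from C leaves a connected set. *)
Lemma connected_comp_rest C y t : connected_in e C -> y \in C -> t \in C :\ y ->
  connected_in e (C :\: comp (C :\ y) t)
  /\ exists2 a, a \in comp (C :\ y) t & e a y.
Proof.
move=> cC yC tC; set D := comp _ _.
have tD : t \in D by apply: comp_mem.
have yD : y \notin D by rewrite !inE eqxx.
have closedD a b : a \in D -> b \in C -> b \notin D -> e a b -> b = y.
  move=> aD bC bD ab; apply/eqP; apply: contraNT bD => bny.
  by apply: comp_closed aD _ ab; rewrite !inE bny.
split; last first.
  have tC' : t \in C by case/setD1P: tC.
  have [a [b [ab aC bC aD bD]]] := connected_exit cC tC' yC tD yD.
  by exists a => //; rewrite -(closedD a b).
apply: (@connected_hub _ y); first by rewrite inE yD.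
move=> z zCD; have [zC zD] := setDP zCD.
rewrite link_sym; apply/negP=> /negP nzy; pose Z := comp (C :\: D) z.
have zZ : z \in Z by apply: comp_mem.
have yZ : y \notin Z by rewrite inE (negPf nzy) andbF.
have [a [b [ab aC bC aZ bZ]]] := connected_exit cC zC yC zZ yZ.
have [_ aD] := setDP (subsetP (comp_sub _ _) a aZ).
have bD : b \in D.
  by apply: contraNT bZ => bD; apply: comp_closed aZ _ ab; rewrite inE bD.
by move: yZ; rewrite -(closedD b a) ?aZ // e_sym.
Qed.

Lemma k4_minor (A0 A1 A2 A3 : {set V}) :
  [/\ connected_in e A0, connected_in e A1, connected_in e A2 & connected_in e A3] ->
  [/\ [disjoint A0 & A1], [disjoint A0 & A2], [disjoint A0 & A3],
      [disjoint A1 & A2] & [disjoint A1 & A3] /\ [disjoint A2 & A3]] ->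
  (let touch A B := exists x y, [/\ x \in A, y \in B & e x y] in
   [/\ touch A0 A1, touch A0 A2, touch A0 A3, touch A1 A2 & touch A1 A3 /\ touch A2 A3]) ->
  has_minor e (complete_graph 4).
Proof.
move=> [c0 c1 c2 c3] [d01 d02 d03 d12 [d13 d23]] /= [t01 t02 t03 t12 [t13 t23]].
exists (fun i : 'I_4 => nth set0 [:: A0; A1; A2; A3] i); split.
- by case=> [[|[|[|[|]]]]].
- by case=> [[|[|[|[|]]]]] // ? [[|[|[|[|]]]]] //= ? _; rewrite // disjoint_sym.
have ts A B : (exists x y, [/\ x \in A, y \in B & e x y]) ->
    exists x y, [/\ x \in B, y \in A & e x y].
  by case=> x [y [xA yB xy]]; exists y, x; rewrite e_sym.
by case=> [[|[|[|[|]]]]] // ? [[|[|[|[|]]]]] //= ? _; rewrite //; apply: ts.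
Qed.

Definition nbr x A := [exists y in A, e x y].

Lemma nbrP x A : reflect (exists2 y, y \in A & e x y) (nbr x A).
Proof. by apply: (iffP exists_inP) => -[y]; exists y. Qed.

Section Terminals.
Variables (u w : V) (B : {set V}).
Hypotheses (uw : u != w) (uB : u \notin B) (wB : w \notin B).
Hypothesis cB : connected_in e B.
Hypothesis outside : link (~: B) u w.

(** The branch sets are u, the part outside B that contains w, P, and the
    component of [B :\: P] that contains Q; the latter touches P since B is
    connected. *)
Lemma k4_of_two_connectors (P Q : {set V}) : connected_in e P -> connected_in e Q ->
  P \subset B -> Q \subset B -> [disjoint P & Q] ->
  nbr u P -> nbr w P -> nbr u Q -> nbr w Q -> has_minor e (complete_graph 4).
Proof.
move=> cP cQ /subsetP sP /subsetP sQ dPQ uP wP uQ wQ.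
have /set0Pn[p pP] := cP.1; have /set0Pn[q qQ] := cQ.1.
have qP : q \notin P by rewrite (disjointFl dPQ).
pose Q' := comp (B :\: P) q; pose W := comp (~: B :\ u) w.
have qBP : q \in B :\: P by rewrite inE qP sQ.
have sQQ' : Q \subset Q'.
  apply: (connected_sub_comp cQ _ qQ); apply/subsetP=> x xQ.
  by rewrite inE sQ // andbT (disjointFl dPQ).
have sQ'B : {subset Q' <= B :\: P} by apply/subsetP/comp_sub.
have wW0 : w \in ~: B :\ u by rewrite !inE eq_sym uw.
have wW : w \in W by apply: comp_mem.
have sW x : x \in W -> x \notin B.
  by move/(subsetP (comp_sub _ _)) => /setD1P[_]; rewrite inE.
have uW : u \notin W by rewrite !inE eqxx.
have disjP A C : (forall x, x \in A -> x \notin C) -> [disjoint A & C].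
  by move=> AC; rewrite disjoint_subset; apply/subsetP.
apply: (@k4_minor [set u] W P Q'); split.
- exact: connected1.
- exact: comp_connected.
- exact: cP.
- exact: comp_connected.
- by apply: disjP => x /set1P->.
- by apply: disjP => x /set1P->; apply: contra uB => /sP.
- by apply: disjP => x /set1P->; apply: contra uB => /sQ'B /setDP[].
- by apply: disjP => x /sW; apply: contra => /sP.
- split; apply: disjP => x.
    by move=> /sW; apply: contra => /sQ'B /setDP[].
  by move=> xP; apply/negP => /sQ'B; rewrite inE xP.
- have [|a [b [ab aA bA aW bW]]] := link_exit (etrans (link_sym _ _ _) outside) wW _; first
  by [].
  exists u, a; rewrite set11; split=> //; rewrite e_sym.
  suff /eqP<- : b == u by [].
  by apply: contraNT bW => bu; apply: comp_closed aW _ ab; rewrite !inE bu -in_setC.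
- by have /nbrP[y yP uy] := uP; exists u, y; rewrite set11.
- by have /nbrP[y /(subsetP sQQ' _) yQ uy] := uQ; exists u, y; rewrite set11.
- by have /nbrP[y yP wy] := wP; exists w, y.
- split; first by have /nbrP[y /(subsetP sQQ' _) yQ wy] := wQ; exists w, y.
  have [||||a [b [ab aB bB aQ bQ]]] := @connected_exit B Q' q p cB.
  + exact: sQ.
  + exact: sP.
  + exact: comp_mem.
  + by apply/negP => /sQ'B; rewrite inE pP.
  exists b, a; split; rewrite // 1?e_sym //.
  by apply: contraNT bQ => bP; apply: comp_closed aQ _ ab; rewrite inE bP.
Qed.

(** L and Q are attached to u, and both touch D.  When L reaches w, a component of
    L is one connector and D, together with the way through Q to u, is in the
    other. *)
Lemma k4_of_crossing (L Q D : {set V}) :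
  connected_in e (u |: L) -> connected_in e (u |: Q) -> connected_in e D ->
  L \subset B -> Q \subset B -> D \subset B ->
  [disjoint L & Q] -> [disjoint L & D] ->
  nbr w L -> nbr w D ->
  (exists a y, [/\ a \in u |: Q, y \in D & e a y]) ->
  has_minor e (complete_graph 4).
Proof.
move=> cL cQ cD sL sQ sD dLQ dLD /nbrP[t tL wt] /nbrP[d dD wd] [a [y [aQ yD ay]]].
have uLF : u \notin L by apply: contra uB => /(subsetP sL).
pose P := comp L t; have tP : t \in P by apply: comp_mem.
have sPL : {subset P <= L} by apply/subsetP/comp_sub.
have dB : d \in B :\: P.
  by rewrite inE (subsetP sD) // andbT; apply/negP=> /sPL; rewrite (disjointFl dLD).
apply: (@k4_of_two_connectors P (comp (B :\: P) d)).
- exact: comp_connected.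
- exact: comp_connected.
- by apply: subset_trans sL; apply: comp_sub.
- by apply: subset_trans (subsetDl _ _); apply: comp_sub.
- by rewrite disjoint_subset; apply/subsetP=> x xP; apply/negP=> /(subsetP (comp_sub _ _));
  rewrite inE xP.
- have [||||b [c [bc bL cL' bP cP]]] := @connected_exit (u |: L) P t u cL.
  + by rewrite inE tL orbT.
  + by rewrite setU11.
  + by [].
  + by apply: contra uLF => /sPL.
  apply/nbrP; exists b; rewrite // e_sym; case/setU1P: cL' => [<-//|cL'].
  by case/negP: cP; apply: comp_closed bP _ bc.
- by apply/nbrP; exists t.
- have cDQ := connectedUe cQ cD aQ yD ay.
  have [||||b [c [bc bL cL' bP cP]]] := @connected_exit _ (comp (B :\: P) d) d u cDQ.
  + by rewrite inE dD orbT.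
  + by rewrite inE setU11.
  + exact: comp_mem.
  + by apply: contra uB => /(subsetP (comp_sub _ _)) /setDP[].
  apply/nbrP; exists b; rewrite // e_sym.
  have cBP : c \in Q :|: D -> c \in B :\: P.
    move=> cQD; rewrite inE (_ : c \in B) ?andbT; last first.
      by case/setUP: cQD => [/(subsetP sQ)|/(subsetP sD)].
    apply/negP=> /sPL cL2; case/setUP: cQD => cX.
      by rewrite (disjointFr dLQ cL2) in cX.
    by rewrite (disjointFr dLD cL2) in cX.
  move: cL'; rewrite -setUA => /setU1P[<-//|/cBP cBP'].
  by case/negP: cP; apply: comp_closed bP _ bc.
- by apply/nbrP; exists d; rewrite ?comp_mem.
Qed.

(** This is Menger's theorem for two paths, in the form of an induction on D.  Two
    disjoint sets L and Q are grown from u, and the remaining connected set D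
    contains the neighbours of w until L or Q reaches one of them.  Remove from D
    a vertex y next to L: since y does not separate u from w, the component D' of
    a neighbour of w in [D :\ y] still touches u, L or Q.  Then [D :\: D'], which
    contains y and is connected, is added to L if D' touches Q or u, and to Q
    otherwise. *)
Lemma k4_grow :
  {in B, forall x, exists K, [/\ connected_in e K, K \subset B :\ x, nbr u K & nbr w K]} ->
  forall n (L Q D : {set V}), #|D| < n ->
  connected_in e (u |: L) -> connected_in e (u |: Q) -> connected_in e D ->
  L \subset B -> Q \subset B -> D \subset B ->
  [/\ [disjoint L & Q], [disjoint L & D] & [disjoint Q & D]] ->
  B \subset L :|: Q :|: D -> nbr w D ->
  (exists a y, [/\ a \in u |: L, y \in D & e a y]) ->
  (exists a y, [/\ a \in u |: Q, y \in D & e a y]) ->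
  has_minor e (complete_graph 4).
Proof.
move=> noCut; elim=> // n IH L Q D ltD cL cQ cD sL sQ sD [dLQ dLD dQD] cov wD tL tQ.
case: (boolP (nbr w L)) => [wL|wL]; first exact: (k4_of_crossing cL cQ cD).
case: (boolP (nbr w Q)) => [wQ|wQ].
  by apply: (k4_of_crossing cQ cL cD) => //; rewrite disjoint_sym.
have [a [y [aL yD ay]]] := tL.
have yB := subsetP sD _ yD.
have [K [cK sK /nbrP[k kK uk] /nbrP[t tK wt]]] := noCut y yB.
have /setD1P[ty tB] := subsetP sK t tK.
have tD : t \in D.
  have := subsetP cov t tB; rewrite !inE -orbA => /or3P[tX|tX|//].
    by case/negP: wL; apply/nbrP; exists t.
  by case/negP: wQ; apply/nbrP; exists t.
have tDy : t \in D :\ y by rewrite !inE ty.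
have [cR [y' y'D' y'y]] := connected_comp_rest cD yD tDy.
set D' := comp (D :\ y) t in cR y'D'.
have tD' : t \in D' by apply: comp_mem.
have cD' : connected_in e D' by apply: comp_connected.
have sD'y : {subset D' <= D :\ y} by apply/subsetP/comp_sub.
have sD' : {subset D' <= D} by move=> x /sD'y /setD1P[].
have yD' : y \notin D' by apply/negP=> /sD'y; rewrite !inE eqxx.
have uD' : u \notin D' by apply: contra uB => /sD' /(subsetP sD).
have ltD' : #|D'| < n.
  apply: leq_trans (_ : #|D| <= n); last by rewrite -ltnS.
  apply: proper_card; rewrite properE; apply/andP; split; first exact/subsetP.
  by apply/subsetPn; exists y.
have wD' : nbr w D' by apply/nbrP; exists t.
set D'' := D :\: D' in cR.
have yD'' : y \in D'' by rewrite inE yD'.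
have sD'' : {subset D'' <= D} by move=> x /setDP[].
have cDsplit x : x \in D -> (x \in D') || (x \in D'').
  by move=> xD; rewrite /D'' [x \in _ :\: _]inE xD andbT orbN.
have touchD' : exists b c, [/\ e b c, b \in D' & c \in u |: (L :|: Q)].
  have cuK : connected_in e (u |: K) := connectedUe (connected1 u) cK (set11 u) kK uk.
  have [||||b [c [bc bK cK' bD' cD'x]]] := @connected_exit _ D' t u cuK => //.
  - by rewrite inE tK orbT.
  - by rewrite setU11.
  exists b, c; split=> //; case/setU1P: cK' => [->|cK']; first by rewrite setU11.
  have /setD1P[cy cB'] := subsetP sK c cK'.
  have := subsetP cov c cB'; rewrite inE => /orP[cLQ|cD2]; first by rewrite inE cLQ orbT.
  by case/negP: cD'x; apply: comp_closed bD' _ bc; rewrite !inE cy.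
have disjS (X Y : {set V}) : {subset X <= D} -> [disjoint Y & D] -> [disjoint Y & X].
  by move=> sX; apply: disjointWr; apply/subsetP.
have sD'B : D' \subset B by apply/subsetP=> x /sD' /(subsetP sD).
have sD''B : D'' \subset B by apply/subsetP=> x /sD'' /(subsetP sD).
have dD : [disjoint D'' & D'] by rewrite disjoint_subset; apply/subsetP=> x /setDP[].
have disjU (X Y Z : {set V}) : [disjoint X & Z] -> [disjoint Y & Z] -> [disjoint X :|: Y & Z].
  by rewrite -!setI_eq0 setIUl setU_eq0 => -> ->.
case: (boolP [exists b in D', [exists c in u |: Q, e b c]]) => [/exists_inP[b bD'
  /exists_inP[c cQ' bc]]|noQ].
  apply: (IH (L :|: D'') Q D') => //.
  - by rewrite setUA; apply: connectedUe cL cR aL yD'' ay.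
  - by rewrite subUset sL.
  - split; last exact: disjS.
      by apply: disjU => //; rewrite disjoint_sym; apply: disjS.
    by apply: disjU => //; apply: disjS.
  - apply/subsetP=> x /(subsetP cov); rewrite !in_setU -orbA.
    by case/or3P=> [->|->|/cDsplit/orP[]->]; rewrite ?orbT.
  - by exists y, y'; rewrite e_sym !in_setU yD'' !orbT.
  - by exists c, b; rewrite e_sym.
have cLb : exists b c, [/\ e b c, b \in D' & c \in L].
  have [b [c [bc bD' cX]]] := touchD'; exists b, c; split=> //.
  apply: contraNT noQ => cL'; apply/exists_inP; exists b => //; apply/exists_inP; exists c
    => //.
  by move: cX; rewrite !inE (negPf cL').
have [b [c [bc bD' cL']]] := cLb.
have [a' [z [a'Q zD a'z]]] := tQ.
have zD'' : z \in D''.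
  case/orP: (cDsplit z zD) => // zD'; case/negP: noQ.
  by apply/exists_inP; exists z => //; apply/exists_inP; exists a' => //; rewrite e_sym.
apply: (IH L (Q :|: D'') D') => //.
- by rewrite setUA; apply: connectedUe cQ cR a'Q zD'' a'z.
- by rewrite subUset sQ.
- split; last by apply: disjU => //; apply: disjS.
    by rewrite disjoint_sym; apply: disjU; rewrite disjoint_sym //; apply: disjS.
  exact: disjS.
- apply/subsetP=> x /(subsetP cov); rewrite !in_setU -orbA.
  by case/or3P=> [->|->|/cDsplit/orP[]->]; rewrite ?orbT.
- by exists c, b; rewrite e_sym inE cL' orbT.
- by exists y, y'; rewrite e_sym !in_setU yD'' !orbT.
Qed.

Lemma cut_vertex : ~ has_minor e (complete_graph 4) -> nbr u B -> nbr w B ->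
  exists2 x, x \in B & forall K, connected_in e K -> K \subset B :\ x -> nbr u K -> ~ nbr w K.
Proof.
move=> noK4 /nbrP[x xB ux] wB'; apply: contra_notP noK4 => noCut.
apply: (@k4_grow _ #|B|.+1 set0 set0 B); rewrite ?setU0 ?sub0set ?set0U //.
- move=> z zB; apply: contra_notP noCut => noK; exists z => // K cK sK uK wK.
  by apply: noK; exists K.
- exact: connected1.
- exact: connected1.
- by rewrite -!setI_eq0 !set0I.
- by exists u, x; rewrite set11.
- by exists u, x; rewrite set11.
Qed.

End Terminals.
End Connectivity.

(** * Cuts of graphs without K4 minor *)

Section Networks.
Import mathcomp.boot.fintype mathcomp.boot.finset.
Variables (V : finType) (e : rel V).
Hypothesis e_sym : ssrbool.symmetric e.
Hypothesis e_irr : irreflexive e.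
Implicit Types (A B D K S : {set V}) (u w x y z : V) (F : {set V * V}).

Definition cut (p : V * V) (S : {set V}) := (p.1 \in S) (+) (p.2 \in S).

Definition induced A := [set p : V * V | [&& e p.1 p.2, p.1 \in A & p.2 \in A]].

(** The network with inner vertices B and terminals u and w; a possible edge
    between the terminals is left out. *)
Definition between B u w :=
  [set p in induced (u |: (w |: B)) | (p.1 \in B) || (p.2 \in B)].

Definition spanned F A := {in F, forall p, (p.1 \in A) && (p.2 \in A)}.

Lemma cutC u w S : cut (u, w) S = cut (w, u) S.
Proof. exact: addbC. Qed.

Lemma cutxx u S : cut (u, u) S = false.
Proof. exact: addbb. Qed.

Lemma cut_pair S x y : x != y -> (#|S :&: [set x; y]| == 1) = cut (x, y) S.
Proof.
move=> xy; rewrite (cardsD1 x) (cardsD1 y) (_ : _ :\ y = set0); last first.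
  by apply/setP=> z; rewrite !inE; case: (z == x) (z == y) => [] []; rewrite /= ?andbF.
rewrite /cut /= !inE cards0 !eqxx orbT (eq_sym y) xy !andbT /=.
by case: (x \in S) (y \in S) => [] [].
Qed.

Lemma cut_closes u x w : closes cut (u, w) (u, x) (x, w).
Proof. by move=> S; rewrite /cut /=; do 3!case: (_ \in S). Qed.

Lemma spannedU1 F A u w : u \in A -> w \in A -> spanned F A -> spanned ((u, w) |: F) A.
Proof. by move=> uA wA sF p /setU1P[->/=|/sF//]; rewrite uA. Qed.

Lemma spanned_induced A : spanned (induced A) A.
Proof. by move=> p; rewrite inE => /and3P[_ -> ->]. Qed.

Lemma spanned_between B u w : spanned (between B u w) (u |: (w |: B)).
Proof. by move=> p; rewrite inE => /andP[/spanned_induced]. Qed.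

(** If S and T agree at the pair (a, b), they coincide on {a, b} after T has been
    complemented if necessary, which does not change the cut. *)
Lemma glue_cut A1 A2 a b S T : A1 :&: A2 \subset [set a; b] ->
  cut (a, b) S = cut (a, b) T ->
  exists Z, forall p, ((p.1 \in A1) && (p.2 \in A1) -> cut p Z = cut p S)
                   /\ ((p.1 \in A2) && (p.2 \in A2) -> cut p Z = cut p T).
Proof.
move=> /subsetP sA ab.
pose Z := [set v | if v \in A1 then v \in S else (v \in T) (+) ((a \in S) (+) (a \in T))].
exists Z => -[p q] /=; split=> /andP[pA qA]; rewrite /cut /= !inE.
  by rewrite pA qA.
have onA v : v \in A2 -> v \in A1 -> (v \in S) = (v \in T) (+) ((a \in S) (+) (a \in T)).
  move=> v2 v1; have /set2P[] : v \in [set a; b] by apply: sA; rewrite inE v1.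
    by move->; case: (a \in S) (a \in T) => [] [].
  by move->; move: ab; rewrite /cut /=; do 4!case: (_ \in _).
have key v : v \in A2 -> (if v \in A1 then v \in S else (v \in T) (+) ((a \in S) (+) (a \in
  T)))
   = (v \in T) (+) ((a \in S) (+) (a \in T)).
  by move=> v2; case: ifP => // /onA->.
by rewrite !key //; do 4!case: (_ \in _).
Qed.

Lemma glues_cut F1 F2 A1 A2 a b : spanned F1 A1 -> spanned F2 A2 ->
  [&& a \in A1, b \in A1, a \in A2 & b \in A2] ->
  A1 :&: A2 \subset [set a; b] -> glues cut F1 F2 (a, b).
Proof.
move=> s1 s2 /and4P[a1 b1 a2 b2] sA S T ab; have [Z Zp] := glue_cut sA ab.
by exists Z => p pF; apply Zp; [apply: (spannedU1 a1 b1 s1) | apply: (spannedU1 a2 b2 s2)].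
Qed.

Lemma joins_cut F1 F2 A1 A2 p q x : spanned F1 A1 -> spanned F2 A2 ->
  [&& p.1 \in A1, p.2 \in A1, q.1 \in A2 & q.2 \in A2] ->
  A1 :&: A2 \subset [set x] -> joins cut F1 p F2 q.
Proof.
case: p q => [p1 p2] [q1 q2] s1 s2 /and4P[a1 b1 a2 b2] sA S T.
have [||Z Zp] := @glue_cut A1 A2 x x S T; rewrite ?cutxx ?setUid //.
by exists Z => p pF; apply Zp; [apply: (spannedU1 a1 b1 s1) | apply: (spannedU1 a2 b2 s2)].
Qed.

Lemma parity_link A u w : link e A u w -> parity cut (induced A) (u, w).
Proof.
move=> /connectP[p pth ->]; elim/last_ind: p pth => [_|p v IH] /=.
  by move=> S T _; rewrite !(@eq_count _ (cut (u, u)) pred0) ?count_pred0 // => Z; rewrite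
    cutxx.
rewrite rcons_path last_rcons => /andP[/IH par vA].
rewrite -[induced A]setUid; apply: parity_series (cut_closes u (last u p) v) par _.
by apply: parityS (@parity1 _ _ cut _); rewrite sub1set inE.
Qed.

(** The terminal w is isolated, so it can change sides in any state. *)
Lemma reducible_flip F A u w : spanned F A -> u \in A -> w \notin A ->
  reducible cut true F (u, w).
Proof.
move=> sF uA wA.
have flip S : exists2 S', {in F, cut ^~ S' =1 cut ^~ S} & cut (u, w) S' = false.
  have uw : u != w by apply: contraNneq wA => <-.
  have [||Z Zp] := @glue_cut A [set u; w] u u S set0; rewrite ?cutxx //.
    apply/subsetP=> v; rewrite !inE => /andP[vA /orP[]/eqP vE]; first by rewrite vE eqxx.
    by rewrite -vE vA in wA.
  exists Z; first by move=> p pF; apply Zp; apply: sF.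
  by have [_ ->] := Zp (u, w); rewrite /cut /= !inE ?eqxx ?orbT.
move=> S T _; rewrite !count_eqb => gap.
have [|x [y [B [SB ux uy]]]] := @count2_split _ (cut (u, w)) S; first by lia.
have [x' xx' x'0] := flip x; have [y' yy' y'0] := flip y.
exists x, y, B, x', y'; split; first by split=> //; apply: Fiber_perm.
by split=> // p pF /=; rewrite xx' ?yy'.
Qed.

(** The pair (u, u) is never cut; gluing along it is gluing at the vertex u. *)
Lemma agreeU1_trivial F u (S T : seq {set V}) : agree cut F S T <-> agree cut ((u, u) |: F)
  S T.
Proof.
split; last exact: agreeS (subsetUr _ _).
by apply: agreeU1; rewrite !(@eq_count _ (cut (u, u)) pred0) ?count_pred0 // => Z; rewrite
  cutxx.
Qed.

Lemma fibers_connected_induced B u w : u \notin B -> w \notin B ->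
  fibers_connected cut ((u, w) |: between B u w) -> fibers_connected cut ((u, w) |: induced
    (u |: (w |: B))).
Proof.
move=> uB wB; apply: fibers_connected_equiv => S T; split; last first.
  by apply: agreeS; apply: setUS; apply/subsetP=> p; rewrite !inE => /andP[].
apply: agree_equiv => -[p q] /setU1P[->|]; first by exists (u, w); rewrite ?setU11.
move=> pI; case: (boolP ((p \in B) || (q \in B))) => pB.
  by exists (p, q) => //; rewrite !inE /= pB; move: pI; rewrite !inE /= => ->; rewrite orbT.
move: pI; rewrite !inE /= => /and3P[pq pA qA].
rewrite negb_or in pB; have /andP[/negPf pB' /negPf qB'] := pB.
rewrite pB' orbF in pA; rewrite qB' orbF in qA; exists (u, w); rewrite ?setU11 //.
case/orP: pA pq => /eqP->; case/orP: qA => /eqP-> //; rewrite ?e_irr // => _ S'.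
exact: cutC.
Qed.

Lemma reducible_induced B u w : u \notin B -> w \notin B ->
  reducible cut true (between B u w) (u, w) ->
  reducible cut true (induced (u |: (w |: B))) (u, w).
Proof.
move=> uB wB red; case: (boolP (e u w)) => uw.
  by apply: (@reducible1 _ _ _ _ (u, w)) => //; rewrite !inE /= uw !eqxx ?orbT.
suff -> : induced (u |: (w |: B)) = between B u w by [].
apply/setP=> -[p q]; rewrite [RHS]in_set andb_idr //=.
rewrite !inE /= => /and3P[pq pA qA]; apply: contraNT uw.
rewrite negb_or => /andP[/negPf pB /negPf qB]; rewrite pB qB !orbF in pA qA.
by case/orP: pA pq => /eqP->; case/orP: qA => /eqP->; rewrite ?e_irr // e_sym.
Qed.

(** The statement that is proved by induction on B. *)
Definition tame B u w :=
  fibers_connected cut ((u, w) |: between B u w) /\ reducible cut true (between B u w) (u, w).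

Lemma betweenC B u w : between B u w = between B w u.
Proof. by rewrite /between setUCA. Qed.

Lemma tameC B u w : tame B u w -> tame B w u.
Proof.
rewrite /tame betweenC => -[q r]; have flip := cutC w u.
have ag (S T : seq {set V}) G : agree cut ((u, w) |: G) S T -> agree cut ((w, u) |: G) S T.
  apply: agree_equiv => p /setU1P[->|pG]; first by exists (u, w); rewrite ?setU11.
  by exists p; rewrite // inE pG orbT.
have ag' (S T : seq {set V}) G : agree cut ((w, u) |: G) S T -> agree cut ((u, w) |: G) S T.
  apply: agree_equiv => p /setU1P[->|pG]; first by exists (w, u); rewrite ?setU11.
  by exists p; rewrite // inE pG orbT.
split; first by apply: fibers_connected_equiv q => S T; split; [apply: ag | apply: ag'].
move=> S T ST; rewrite !count_eqb !(eq_count flip) => lt.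
have [|x [y [A [x' [y' [[SA xb yb xb' yb'] ag1]]]]]] := r S T ST; first by rewrite !count_eqb.
exists x, y, A, x', y'; split=> //; split; rewrite ?flip //.
by apply: fiber_conn_equiv SA => A' B'; apply: ag.
Qed.

Lemma between_pendant B u w : u \notin B -> w \notin B -> ~~ nbr e w B ->
  between B u w = induced (u |: B).
Proof.
move=> uB wB wN; have noN v : v \in B -> e w v = false.
  by move=> vB; apply: contraNF wN => wv; apply/nbrP; exists v.
apply/setP=> -[p q]; rewrite !inE /=; case pq: (e p q) => //=.
apply/idP/idP=> [/andP[/andP[pA qA] pqB]|/andP[pA qA]].
  have pB : (p == w) = false.
    apply: contraTF pqB => /eqP pw; rewrite pw (negPf wB) /=.
    by apply: contraTN pq; rewrite pw => /noN->.
  have qB : (q == w) = false.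
    apply: contraTF pqB => /eqP qw; rewrite qw (negPf wB) orbF.
    by apply: contraTN pq; rewrite qw e_sym => /noN->.
  by rewrite pB in pA; rewrite qB in qA; rewrite pA qA.
case/orP: pA => [/eqP pE|->]; case/orP: qA => [/eqP qE|->]; rewrite ?orbT //.
- by rewrite pE qE e_irr in pq.
- by rewrite pE eqxx ?orbT.
- by rewrite qE eqxx ?orbT.
Qed.

(** The network hangs at u only.  Since ux is an edge, it is the network between
    the terminals u and x together with this edge. *)
Lemma tame_pendant B u w x : u != w -> u \notin B -> w \notin B -> ~~ nbr e w B ->
  x \in B -> e u x -> tame (B :\ x) u x -> tame B u w.
Proof.
move=> uw uB wB wN xB ux [q _]; rewrite /tame between_pendant //.
have {}q : fibers_connected cut (induced (u |: B)).
  have := fibers_connected_induced _ _ q; rewrite setD1K // => /(_ _ _).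
  rewrite [_ |: induced _](setUidPr _).
    by apply; rewrite !inE ?eqxx // (negPf uB) andbF.
  by rewrite sub1set !inE /= ux eqxx xB orbT.
(* The edge uw shares only the vertex u with the network. *)
have uu : glues cut [set (u, w)] (induced (u |: B)) (u, u).
  apply: (@glues_cut _ _ [set u; w] (u |: B)).
  - by move=> p /set1P->; rewrite !inE !eqxx orbT.
  - exact: spanned_induced.
  - by rewrite !inE eqxx.
  - apply/subsetP=> v; rewrite !inE => /andP[/orP[/eqP->|/eqP->]]; rewrite ?eqxx //.
    by rewrite eq_sym (negPf uw) (negPf wB).
split; last by apply: reducible_flip (@spanned_induced _) (setU11 _ _) _; rewrite !inE
  eq_sym negb_or uw.
have trivE F (S T : seq {set V}) := agreeU1_trivial F u S T.
have := fibers_connected_glue uu (fibers_connected_equiv (trivE _) (@fibers_connected1 _ _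
  cut (u, w))) (fibers_connected_equiv (trivE _) q).
by apply: fibers_connected_equiv => S T; rewrite -trivE.
Qed.

Lemma tame_union B1 B2 u w : u != w -> u \notin B1 :|: B2 -> w \notin B1 :|: B2 ->
  [disjoint B1 & B2] -> (forall a b, a \in B1 -> b \in B2 -> ~~ e a b) ->
  tame B1 u w -> tame B2 u w -> tame (B1 :|: B2) u w.
Proof.
rewrite !inE !negb_or => uw /andP[u1 u2] /andP[w1 w2] dB nE [q1 r1] [q2 r2].
rewrite /tame; have -> : between (B1 :|: B2) u w = between B1 u w :|: between B2 u w.
  apply/setP=> -[p q]; rewrite in_setU /between ![_ \in [set _ in _ | _]]in_set /=.
  rewrite ![_ \in induced _]in_set /=; case pq: (e p q) => //=; have qp : e q p by rewrite
    e_sym.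
  rewrite !in_setU !in_set1; apply/idP/idP.
    case/andP=> /andP[/or3P[pA|pA|/orP[pA|pA]]] /or3P[qA|qA|/orP[qA|qA]] in_;
      rewrite ?pA ?qA ?orbT //; try (move/eqP: (pA) => pE); try (move/eqP: (qA) => qE);
      try (by move: in_; rewrite pE qE ?(negPf u1) ?(negPf u2) ?(negPf w1) ?(negPf w2)).
      by rewrite (negPf (nE _ _ pA qA)) in pq.
    by rewrite (negPf (nE _ _ qA pA)) in qp.
  by case/orP=> /andP[/andP[/or3P[]pA /or3P[]qA] /orP[]in_]; rewrite ?pA ?qA ?in_ ?orbT.
have glue : glues cut (between B1 u w) (between B2 u w) (u, w).
  apply: glues_cut (@spanned_between B1 u w) (@spanned_between B2 u w) _ _.
    by rewrite !inE !eqxx !orbT.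
  apply/subsetP=> v; rewrite !inE => /andP[/or3P[->//|->|v1]]; rewrite ?orbT //.
  by rewrite (disjointFr dB v1) orbF.
by split; [apply: fibers_connected_glue | apply: reducible_glue].
Qed.

(** Here x separates u from w. *)
Lemma tame_series B1 B2 u w x : u != w -> u != x -> w != x ->
  u \notin B1 :|: B2 -> w \notin B1 :|: B2 -> x \notin B1 :|: B2 ->
  [disjoint B1 & B2] -> (forall a b, a \in B1 -> b \in B2 -> ~~ e a b) ->
  ~~ nbr e w B1 -> ~~ nbr e u B2 ->
  link e (u |: (x |: B1)) u x -> link e (x |: (w |: B2)) x w ->
  tame B1 u x -> tame B2 x w -> tame (x |: (B1 :|: B2)) u w.
Proof.
rewrite !inE !negb_or => uw ux wx /andP[u1 u2] /andP[w1 w2] /andP[x1 x2] dB nE nw nu l1 l2.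
move=> [q1 r1] [q2 r2].
rewrite /tame; have -> : between (x |: (B1 :|: B2)) u w = induced (u |: (x |: B1)) :|:
  induced (x |: (w |: B2)).
  have nB v : v \in B1 -> e w v = false.
    by move=> vB; apply: contraNF nw => wv; apply/nbrP; exists v.
  have nB' v : v \in B2 -> e u v = false.
    by move=> vB; apply: contraNF nu => uv; apply/nbrP; exists v.
  apply/setP=> -[p q]; rewrite in_setU /between [_ \in [set _ in _ | _]]in_set /=.
  rewrite ![_ \in induced _]in_set /=.
  case pq: (e p q) => //=; have qp : e q p by rewrite e_sym.
  rewrite !in_setU !in_set1; apply/idP/idP.
    case/andP=> /andP[/or3P[pA|pA|/or3P[pA|pA|pA]]] /or3P[qA|qA|/or3P[qA|qA|qA]] in_;
      rewrite ?pA ?qA ?orbT //; try (move/eqP: (pA) => pE); try (move/eqP: (qA) => qE);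
      try (by rewrite pE qE e_irr in pq);
      try (by move: in_; rewrite pE qE ?(negPf ux) ?(negPf wx) ?(negPf u1) ?(negPf u2)
        ?(negPf w1) ?(negPf w2));
      try (by rewrite pE nB in pq); try (by rewrite pE nB' in pq);
      try (by rewrite qE nB in qp); try (by rewrite qE nB' in qp).
      by rewrite (negPf (nE _ _ pA qA)) in pq.
    by rewrite (negPf (nE _ _ qA pA)) in qp.
  case/orP=> /andP[/or3P[pA|pA|pA]] /or3P[qA|qA|qA];
    rewrite ?pA ?qA ?orbT //; try (move/eqP: (pA) => pE); try (move/eqP: (qA) => qE);
    by rewrite pE qE e_irr in pq.
have {}q1 := fibers_connected_induced u1 x1 q1; have {}q2 := fibers_connected_induced x2 w2
  q2.
have {}r1 := reducible_induced u1 x1 r1; have {}r2 := reducible_induced x2 w2 r2.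
have p1 := parity_link l1; have p2 := parity_link l2.
have sw : spanned [set (u, w)] [set u; w] by move=> p /set1P->; rewrite !inE !eqxx orbT.
have jo : joins cut (induced (u |: (x |: B1))) (u, x) (induced (x |: (w |: B2))) (x, w).
  apply: (joins_cut (x := x) (@spanned_induced _) (@spanned_induced _)).
    by rewrite !inE !eqxx !orbT.
  apply/subsetP=> v; rewrite !inE => /andP[/or3P[/eqP->|->//|v1]].
    by rewrite (negPf ux) (negPf uw) (negPf u2).
  case/or3P=> [//|/eqP vw|]; first by rewrite -vw v1 in w1.
  by rewrite (disjointFr dB v1).
have cl := cut_closes u x w.
split; last exact: (reducible_series cl jo).
apply: (fibers_connected_series cl jo) => //.
  apply: (joins_cut (x := u) (@spanned_induced _) sw).
    by rewrite !inE !eqxx !orbT.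
  apply/subsetP=> v; rewrite !inE => /andP[vA /orP[//|/eqP vE]]; move: vA; rewrite vE.
  by rewrite (negPf wx) (negPf w1) [w == u]eq_sym (negPf uw).
apply: (joins_cut (x := w) (A1 := [set x; w]) _ sw).
- by move=> p /set1P->; rewrite !inE !eqxx orbT.
- by rewrite !inE !eqxx !orbT.
- apply/subsetP=> v; rewrite !inE => /andP[/orP[/eqP->|->//]].
  by rewrite [x == u]eq_sym (negPf ux).
Qed.

(** Every component of B is adjacent to u or w. *)
Definition anchored B u w := forall D, D \subset B -> D != set0 ->
  exists a b, [/\ e a b, a \in D, b \notin D & b \in u |: (w |: B)].

Lemma tame0 u w : u != w -> tame set0 u w.
Proof.
move=> uw; rewrite /tame (_ : between _ _ _ = set0); last first.
  by apply/setP=> p; rewrite !inE andbF.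
rewrite setU0; split; first exact: fibers_connected1.
apply: (reducible_flip (A := [set u])) (set11 u) _; first by move=> p; rewrite !inE.
by rewrite inE eq_sym.
Qed.

Lemma link_comp_vertex B x y : connected_in e B -> x \in B -> y \in B :\ x ->
  link e (x |: comp e (B :\ x) y) x y.
Proof.
move=> cB xB yBx; have [_ [a aK ax]] := connected_comp_rest e_sym cB xB yBx.
have yK := comp_mem e yBx; rewrite e_sym in ax.
have cxK := connectedUe e_sym (connected1 e_sym x) (comp_connected e_sym yBx) (set11 x) aK ax.
by apply: (connected_link cxK); rewrite in_setU1 ?eqxx ?yK ?orbT.
Qed.

(** B1 consists of the components of [B :\ x] adjacent to u.  The terminals u and x
    of B1 are joined outside B1: go from x to w through the rest of B and from w
    to u outside B. *)
Lemma tame_cut_vertex B u w x : u != w -> u \notin B -> w \notin B ->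
  connected_in e B -> x \in B ->
  (forall K, connected_in e K -> K \subset B :\ x -> nbr e u K -> ~ nbr e w K) ->
  nbr e u B -> nbr e w B -> link e (~: B) u w ->
  (forall B' u' w', #|B'| < #|B| -> u' != w' -> u' \notin B' -> w' \notin B' ->
    link e (~: B') u' w' -> anchored B' u' w' -> tame B' u' w') ->
  tame B u w.
Proof.
move=> uw uB wB cB xB noK /nbrP[p pB up] /nbrP[q qB wq] out IH.
have ux : u != x by apply: contraNneq uB => ->.
have wx : w != x by apply: contraNneq wB => ->.
pose C := comp e (B :\ x).
have CE y z : y \in B :\ x -> z \in C y -> C z = C y.
  move=> yB; rewrite inE => /andP[zB yz]; apply/setP=> v; rewrite !inE; congr (_ && _).
  by apply/idP/idP; apply: connect_trans; rewrite // -/(link e _ z y) link_sym.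
pose B1 := [set y in B :\ x | nbr e u (C y)]; pose B2 := (B :\ x) :\: B1.
have sB1 : {subset B1 <= B :\ x} by move=> y; rewrite in_set => /andP[].
have sB2 : {subset B2 <= B :\ x} by move=> y /setDP[].
have sBx y : y \in B :\ x -> y \in B by case/setD1P.
have memC y : y \in B :\ x -> y \in C y := @comp_mem _ e _ y.
have sCB y : {subset C y <= B :\ x} by apply/subsetP/comp_sub.
have C1 y : y \in B1 -> {subset C y <= B1}.
  move=> yB1 z zC; rewrite in_set (sCB y z zC) /= (CE y z) // ?sB1 //.
  by move: yB1; rewrite in_set => /andP[].
have C2 y : y \in B2 -> {subset C y <= B2}.
  move=> yB2 z zC; have [yB ynB1] := setDP yB2.
  rewrite in_setD (sCB y z zC) andbT; apply: contra ynB1 => zB1.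
  by apply: (C1 z zB1); rewrite (CE y z) // memC.
have [xB1 xB2] : x \notin B1 /\ x \notin B2.
  by split; [apply/negP=> /sB1 | apply/negP=> /sB2]; rewrite !inE eqxx.
have [uB1 uB2] : u \notin B1 /\ u \notin B2.
  by split; apply: contra uB; [move=> /sB1/sBx | move=> /sB2/sBx].
have [wB1 wB2] : w \notin B1 /\ w \notin B2.
  by split; apply: contra wB; [move=> /sB1/sBx | move=> /sB2/sBx].
have BE : B = x |: (B1 :|: B2).
  apply/setP=> y; rewrite in_setU1; case: (eqVneq y x) => [->|yx] //=.
  rewrite in_setU in_setD in_setD1 yx /=; case: (boolP (y \in B1)) => [/sB1/sBx->|] //.
have dB : [disjoint B1 & B2].
  by rewrite disjoint_sym disjoint_subset; apply/subsetP=> y /setDP[].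
have nE a b : a \in B1 -> b \in B2 -> ~~ e a b.
  move=> aB1 bB2; apply/negP=> ab; have [_ /negP] := setDP bB2; apply.
  by apply: (C1 a aB1); apply: comp_closed (memC a (sB1 a aB1)) (sB2 b bB2) ab.
have nw : ~~ nbr e w B1.
  apply/negP=> /nbrP[y yB1 wy].
  apply: (noK (C y)); first exact: comp_connected (sB1 y yB1).
  - exact: comp_sub.
  - by move: yB1; rewrite in_set => /andP[].
  - by apply/nbrP; exists y; rewrite ?memC ?sB1.
have nu : ~~ nbr e u B2.
  apply/negP=> /nbrP[y yB2 uy]; have [yB /negP] := setDP yB2; apply.
  by rewrite in_set yB; apply/nbrP; exists y; rewrite ?memC.
have l1 : link e (u |: (x |: B1)) u x.
  case: (eqVneq p x) => [px|px]; first by apply: link1; rewrite ?inE ?eqxx ?orbT // -px.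
  have pB1 : p \in B1.
    have : p \in B by []; rewrite {1}BE !in_setU in_set1 (negPf px) /= => /orP[//|pB2].
    by case/negP: nu; apply/nbrP; exists p.
  apply: connect_trans (link1 up _ _) _; rewrite ?in_setU ?pB1 ?set11 ?orbT //.
  rewrite -/(link e _ p x) link_sym //; apply: linkS (link_comp_vertex cB xB (sB1 p pB1)).
  by apply: subset_trans (subsetUr _ _); apply: setUS; apply/subsetP/C1.
have l2 : link e (x |: (w |: B2)) x w.
  rewrite link_sym //.
  case: (eqVneq q x) => [qx|qx]; first by apply: link1; rewrite ?inE ?eqxx ?orbT // -qx.
  have qB2 : q \in B2.
    have : q \in B by []; rewrite {1}BE !in_setU in_set1 (negPf qx) /= => /orP[qB1|//].
    by case/negP: nw; apply/nbrP; exists q.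
  apply: connect_trans (link1 wq _ _) _; rewrite ?in_setU ?qB2 ?set11 ?orbT //.
  rewrite -/(link e _ q x) link_sym //; apply: linkS (link_comp_vertex cB xB (sB2 q qB2)).
  apply/subsetP=> v; rewrite !in_setU1 => /orP[->//|/(C2 _ qB2)->]; by rewrite !orbT.
have out1 : link e (~: B1) u w.
  by apply: linkS out; rewrite setCS; apply/subsetP=> y /sB1/sBx.
have out2 : link e (~: B2) u w.
  by apply: linkS out; rewrite setCS; apply/subsetP=> y /sB2/sBx.
have l1' : link e (~: B2) u x.
  apply: linkS l1; apply/subsetP=> v; rewrite !in_setU !in_set1 in_setC =>
    /or3P[/eqP->|/eqP->|vB1] //.
  by rewrite (disjointFr dB).
have l2' : link e (~: B1) x w.
  apply: linkS l2; apply/subsetP=> v; rewrite !in_setU !in_set1 in_setC =>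
    /or3P[/eqP->|/eqP->|vB2] //.
  by rewrite (disjointFl dB).
have ltB (B' : {set V}) : {subset B' <= B :\ x} -> #|B'| < #|B|.
  move=> sB'; apply: proper_card; rewrite properE; apply/andP; split.
    by apply/subsetP=> y /sB'/sBx.
  by apply/subsetPn; exists x => //; apply/negP=> /sB'; rewrite !inE eqxx.
rewrite BE; apply: tame_series l1 l2 _ _ => //; rewrite ?in_setU ?negb_or.
- by rewrite uB1.
- by rewrite wB1.
- by rewrite xB1.
- apply: (IH B1) => //; first exact: ltB.
    by apply: connect_trans out1 _; rewrite -/(link e _ w x) link_sym.
  move=> D sD /set0Pn[d dD].
  have dB' : d \in B by apply/sBx/sB1/(subsetP sD).
  have [|a [b [ab aB bB aD bD]]] := connected_exit cB dB' xB dD.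
    by apply: contra xB1 => /(subsetP sD).
  exists a, b; split=> //; move: bB; rewrite {1}BE !in_setU1 in_setU.
  case/or3P=> [->|->|bB2]; rewrite ?orbT //.
  by rewrite (negPf (nE a b (subsetP sD a aD) bB2)) in ab.
- apply: (IH B2) => //; first exact: ltB.
  + by rewrite eq_sym.
  + by apply: connect_trans out2; rewrite -/(link e _ x u) link_sym.
  move=> D sD /set0Pn[d dD].
  have dB' : d \in B by apply/sBx/sB2/(subsetP sD).
  have [|a [b [ab aB bB aD bD]]] := connected_exit cB dB' xB dD.
    by apply: contra xB2 => /(subsetP sD).
  exists a, b; split=> //; move: bB; rewrite {1}BE !in_setU1 in_setU.
  case/or3P=> [->|bB1|->]; rewrite ?orbT //.
  by rewrite e_sym (negPf (nE b a bB1 (subsetP sD a aD))) in ab.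
Qed.

(** The hypothesis [link e (~: B) u w] replaces the edge uw in the K4 minors that
    have to be excluded: it is inherited by the parts, whereas the graph itself
    never changes. *)
Lemma tame_k4_free : ~ has_minor e (complete_graph 4) ->
  forall n B u w, #|B| < n -> u != w -> u \notin B -> w \notin B ->
  link e (~: B) u w -> anchored B u w -> tame B u w.
Proof.
move=> noK4; elim=> // n IH B u w ltB uw uB wB out anch.
case: (set_0Vmem B) => [->|[y yB]]; first exact: tame0.
pose C := comp e B y; have yC : y \in C by apply: comp_mem.
have sCB : C \subset B by apply: comp_sub.
have IHB (B' : {set V}) u' w' : B' \proper B -> u' != w' -> u' \notin B' -> w' \notin B' ->
    link e (~: B') u' w' -> anchored B' u' w' -> tame B' u' w'.
  by move=> /proper_card lt; apply: IH; apply: leq_trans lt _; rewrite -ltnS.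
case: (eqVneq C B) => [CB|nCB].
  have cB : connected_in e B by rewrite -CB; apply: comp_connected.
  have pend u' w' : u' != w' -> u' \notin B -> w' \notin B -> nbr e u' B -> ~~ nbr e w' B
    -> tame B u' w'.
    move=> uw' uB' wB' /nbrP[x xB ux] nw; apply: (tame_pendant uw' uB' wB' nw xB ux).
    have xnB : x \notin B :\ x by rewrite !inE eqxx.
    have unB : u' \notin B :\ x by rewrite !inE (negPf uB') andbF.
    apply: IHB => //.
    - by apply: properD1.
    - by apply: contraNneq uB' => ->.
    - by apply: link1; rewrite // in_setC.
    move=> D sD /set0Pn[d dD]; have /setD1P[_ dB] := subsetP sD d dD.
    have [|a [b [ab aB bB aD bD]]] := connected_exit cB dB xB dD.
      by apply: contra xnB => /(subsetP sD).
    by exists a, b; split=> //; rewrite !inE bB andbT; case: (b == x); rewrite !orbT.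
  case: (boolP (nbr e u B)) => uN; case: (boolP (nbr e w B)) => wN.
  - have [x xB sep] := cut_vertex e_sym uw uB wB cB out noK4 uN wN.
    apply: (tame_cut_vertex uw uB wB cB xB sep uN wN out).
    by move=> B' u' w' lt; apply: IH; apply: leq_trans lt _; rewrite -ltnS.
  - exact: pend.
  - by apply: tameC; apply: pend; rewrite // eq_sym.
  have [|a [b [ab aB bB]]] := anch B (subxx _); first by apply/set0Pn; exists y.
  rewrite in_setU1 in_setU1 (negPf bB) orbF => /orP[]/eqP bE.
    by case/negP: uN; apply/nbrP; exists a; rewrite // e_sym -bE.
  by case/negP: wN; apply/nbrP; exists a; rewrite // e_sym -bE.
have CC a b : a \in C -> b \in B :\: C -> ~~ e a b.
  move=> aC /setDP[bB bC]; apply: contra bC => ab; exact: comp_closed aC bB ab.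
have BE : B = C :|: (B :\: C) by rewrite -{1}(setIidPr sCB) setID.
have sDB : B :\: C \subset B by apply: subsetDl.
rewrite BE; apply: tame_union => //; rewrite -?BE //.
- by rewrite disjoint_sym disjoint_subset; apply/subsetP=> v /setDP[].
- apply: IHB => //.
  + by rewrite properEneq nCB.
  + by apply: contra uB => /(subsetP sCB).
  + by apply: contra wB => /(subsetP sCB).
  + by apply: linkS out; rewrite setCS.
  move=> D sD D0; have [|a [b [ab aD bD bB]]] := anch D _ D0; first exact: subset_trans sCB.
  exists a, b; split=> //; move: bB; rewrite !in_setU1 => /or3P[->|->|bB]; rewrite ?orbT //.
  by rewrite (comp_closed (subsetP sD a aD) bB ab) !orbT.
- apply: IHB => //.
  + rewrite properE sDB; apply/subsetPn; exists y => //; by rewrite in_setD yC.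
  + by apply: contra uB => /setDP[].
  + by apply: contra wB => /setDP[].
  + by apply: linkS out; rewrite setCS.
  move=> D sD D0; have [|a [b [ab aD bD bB]]] := anch D _ D0; first exact: subset_trans sDB.
  exists a, b; split=> //; move: bB; rewrite !in_setU1 => /or3P[->|->|bB]; rewrite ?orbT //.
  rewrite in_setD bB andbT !orbA; apply/orP; right; apply/negP=> bC.
  by case/negP: (CC b a bC (subsetP sD a aD)); rewrite e_sym.
Qed.

(** Take for u and w the ends of any edge, and for B all other vertices. *)
Lemma fibers_connected_k4_free : connected_graph e -> ~ has_minor e (complete_graph 4) ->
  fibers_connected cut (induced setT).
Proof.
move=> [/set0Pn[v _] conn] noK4.
have cG : connected_in e [set: V] by split=> //; apply/set0Pn; exists v.
case: (pickP (fun p : V * V => e p.1 p.2)) => [[u w] /= uw|noE]; last first.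
  have -> : induced setT = set0 by apply/setP=> p; rewrite !inE noE.
  have := @fibers_connected1 _ _ cut (v, v); apply: fibers_connected_equiv => S T.
  by rewrite (agreeU1_trivial set0 v) setU0.
have unw : u != w by apply: contraTneq uw => ->; rewrite e_irr.
pose B := ~: [set u; w].
have uB : u \notin B by rewrite !inE eqxx.
have wB : w \notin B by rewrite !inE eqxx orbT.
have UE : u |: (w |: B) = setT.
  by apply/setP=> x; rewrite !inE; case: (x == u) (x == w) => [] [].
have [||q _] := tame_k4_free noK4 (ltnSn #|B|) unw uB wB.
- by apply: link1; rewrite // in_setC.
- move=> D sD /set0Pn[d dD].
  have uD : u \notin D by apply: contra uB => /(subsetP sD).
  have [a [b [ab _ _ aD bD]]] := connected_exit cG (in_setT d) (in_setT u) dD uD.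
  by exists a, b; rewrite UE in_setT.
have := fibers_connected_induced uB wB q; rewrite UE (setUidPr _) // sub1set !inE /= uw.
by [].
Qed.

End Networks.

(** * Partitions into the branch sets of a K4 minor *)

Section K4Partition.
Import mathcomp.boot.fintype mathcomp.boot.finset.
Variables (V : finType) (e : rel V).
Hypothesis e_sym : ssrbool.symmetric e.

Definition k4_colouring (f : V -> 'I_4) :=
  (forall i, connected_in e [set v | f v == i]) /\
  (forall i j, i != j -> exists x y, [/\ f x = i, f y = j & e x y]).

(** In a connected graph a vertex next to a branch set can be added to it, until
    the branch sets cover everything. *)
Lemma k4_colouring_exists : connected_graph e -> has_minor e (complete_graph 4) ->
  exists f, k4_colouring f.
Proof.
move=> cG [B [cB dB tB]].
have [n] := ubnP #|~: \bigcup_i B i|; elim: n B cB dB tB => // n IH B cB dB tB ltn.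
case: (boolP [exists y, y \notin \bigcup_i B i]) => [/existsP[y yB]|].
  have /set0Pn[x0 x0B] := (cB ord0).1.
  have x0U : x0 \in \bigcup_i B i by apply/bigcupP; exists ord0.
  have [u [v [uv _ _ uU vU]]] := connected_exit cG (in_setT x0) (in_setT y) x0U yB.
  have /bigcupP[k _ uk] := uU.
  have vB i : v \notin B i by apply: contra vU => vi; apply/bigcupP; exists i.
  pose B' i := if i == k then B i :|: [set v] else B i.
  have sB i : {subset B i <= B' i} by move=> z; rewrite /B'; case: ifP => // _ zB; rewrite
    inE zB.
  apply: (IH B').
  - move=> i; rewrite /B'; case: eqP => // ->.
    by apply: connectedUe (cB k) (connected1 e_sym v) uk (set11 v) uv.
  - move=> i j ij; rewrite disjoint_subset; apply/subsetP=> z; rewrite !inE /B'.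
    have dij : z \in B i -> z \notin B j by move=> zi; rewrite (disjointFr (dB i j ij) zi).
    case: eqP => ik; case: eqP => jk; rewrite ?inE => zi; rewrite ?inE.
    + by rewrite ik jk eqxx in ij.
    + by case/orP: zi => [/dij|/eqP->].
    + by rewrite negb_or dij //=; apply: contraTneq zi => ->.
    + exact: dij.
  - by move=> i j /tB[x [y' [xi yj xy]]]; exists x, y'; split; rewrite // sB.
  apply: leq_trans (_ : #|~: \bigcup_i B i| <= n); last by rewrite -ltnS.
  apply: proper_card; rewrite properE; apply/andP; split.
    by rewrite setCS; apply/bigcupsP=> i _; apply/subsetP=> z /sB zB; apply/bigcupP; exists i.
  apply/subsetPn; exists v; rewrite inE // negbK; apply/bigcupP; exists k => //.
  by rewrite /B' eqxx !inE eqxx orbT.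
rewrite negb_exists => /forallP cov.
have /fin_all_exists[f fB] v : exists i, v \in B i.
  by have /negPn/bigcupP[i _ vi] := cov v; exists i.
have fP v i : v \in B i -> f v = i.
  by move=> vi; apply/eqP; apply: contraTT vi => /dB d; rewrite (disjointFr d (fB v)).
have fE i : [set v | f v == i] = B i.
  by apply/setP=> v; rewrite inE; apply/eqP/idP=> [<-|/fP].
exists f; split=> [i|i j /tB[x [y [/fP xi /fP yj xy]]]]; first by rewrite fE.
by exists x, y.
Qed.

End K4Partition.

Import Order.TTheory GRing.Theory Num.Theory.
Local Open Scope ring_scope.

(** * Binomials in toric ideals *)

Section IdealSpan.
Variables (K : fieldType) (N : nat).
Implicit Types (S : set {mpoly K[N]}) (f g : {mpoly K[N]}) (m u : 'X_{1..N}).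

Lemma ideal_span0 S : ideal_span S 0.
Proof. by exists 0, (fun=> 0), (fun=> 0); split; [case | rewrite big_ord0]. Qed.

Lemma ideal_spanD S f g : ideal_span S f -> ideal_span S g -> ideal_span S (f + g).
Proof.
move=> [n1 [g1 [h1 [S1 ->]]]] [n2 [g2 [h2 [S2 ->]]]].
pose pick T (x1 : 'I_n1 -> T) (x2 : 'I_n2 -> T) i :=
  match split i with inl j => x1 j | inr j => x2 j end.
exists (n1 + n2)%N, (pick _ g1 g2), (pick _ h1 h2); split.
  by move=> i; rewrite /pick; case: (split i).
rewrite big_split_ord /=; congr (_ + _); apply: eq_bigr => i _; rewrite /pick.
  by rewrite -[lshift _ _]/(unsplit (inl i)) unsplitK.
by rewrite -[rshift _ _]/(unsplit (inr i)) unsplitK.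
Qed.

Lemma ideal_spanMl S f g : ideal_span S f -> ideal_span S (g * f).
Proof.
move=> [n [c [h [Sh ->]]]]; exists n, (fun i => g * c i), h; split=> //.
by rewrite mulr_sumr; apply: eq_bigr => i _; rewrite mulrA.
Qed.

Lemma ideal_span_gen S f : S f -> ideal_span S f.
Proof. by move=> Sf; exists 1, (fun=> 1), (fun=> f); rewrite big_ord1 mul1r. Qed.

Lemma ideal_span_sum S n (g h : 'I_n -> {mpoly K[N]}) :
  (forall i, ideal_span S (h i)) -> ideal_span S (\sum_i g i * h i).
Proof.
move=> Sh; elim/big_ind: _ => [||i _]; [exact: ideal_span0 | exact: ideal_spanD |].
exact: ideal_spanMl.
Qed.

Lemma ideal_span_sub S S' : (forall f, S f -> ideal_span S' f) ->
  forall f, ideal_span S f -> ideal_span S' f.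
Proof. by move=> SS' f [n [g [h [Sh ->]]]]; apply: ideal_span_sum => i; apply/SS'. Qed.

Lemma msupp_binomial m1 m2 m : m1 != m2 ->
  (m \in msupp ('X_[m1] - 'X_[m2] : {mpoly K[N]})) = (m == m1) || (m == m2).
Proof.
move=> nm; rewrite mcoeff_msupp mcoeffB !mcoeffX ![_ == m]eq_sym.
case: (eqVneq m m1) => [->|_]; first by rewrite (negPf nm) subr0 oner_eq0.
by case: (eqVneq m m2) => _; rewrite ?sub0r ?oppr_eq0 ?oner_eq0 ?subrr ?eqxx.
Qed.

End IdealSpan.

Section Toric.
Variables (K : fieldType) (d N : nat) (a : 'I_N -> 'rV[int]_d).
Hypothesis a_ge0 : forall i j, 0 <= a i 0 j.
Implicit Types (m u : 'X_{1..N}) (f : {mpoly K[N]}).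

Definition weight m (j : 'I_d) : nat := (\sum_i m i * `|a i 0%R j|)%N.

Definition same_fiber m1 m2 := mdeg m1 = mdeg m2 /\ weight m1 =1 weight m2.

(** As the lattice points are nonnegative, the Laurent monomials that define the
    toric ideal are ordinary monomials, with these exponents. *)
Definition generator_exponent (i : 'I_N) : 'X_{1..d.+1} :=
  ((\sum_(j < d) U_(lift ord_max j) *+ `|a i 0%R j|) + U_(ord_max))%MM.

Definition image_exponent m : 'X_{1..d.+1} := (\sum_i generator_exponent i *+ m i)%MM.

Local Notation phi := (mmap (@mpolyC d.+1 K) (fun i => 'X_[generator_exponent i])).

Lemma phiX m : phi 'X_[m] = 'X_[image_exponent m].
Proof.
rewrite mmapX /mmap1 /image_exponent -mprodXE; apply: eq_bigr => i _.
by rewrite mpolyXn.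
Qed.

Lemma toric_mapE f : toric_map a f = tofrac (phi f).
Proof.
rewrite /toric_map /mmap rmorph_sum; apply: eq_bigr => m _ /=.
rewrite rmorphM; congr (_ * _); rewrite /mmap1 rmorph_prod; apply: eq_bigr => i _.
rewrite rmorphXn; congr (_ ^+ _); rewrite /toric_monomial /generator_exponent mpolyXD rmorphM.
congr (_ * _); rewrite -mprodXE rmorph_prod; apply: eq_bigr => j _.
by rewrite -mpolyXn rmorphXn /toric_var; case: (a i 0 j) (a_ge0 i j).
Qed.

Lemma toric_idealE f : toric_ideal K a f <-> phi f = 0.
Proof.
rewrite /toric_ideal /= toric_mapE; split=> [/eqP|->]; last by rewrite rmorph0.
by rewrite tofrac_eq0 => /eqP.
Qed.

Lemma image_exponentE m1 m2 : image_exponent m1 = image_exponent m2 <-> same_fiber m1 m2.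
Proof.
have tE m : (image_exponent m ord_max = mdeg m) * (forall j, image_exponent m (lift ord_max
  j) = weight m j).
  split=> [|j]; rewrite /image_exponent mnm_sumE.
    rewrite mdegE; apply: eq_bigr => i _; rewrite mulmnE mnmDE mnm_sumE mnm1E eqxx.
    rewrite big1 ?add0n ?mul1n // => j _; rewrite mulmnE mnm1E.
    by rewrite eq_sym (negPf (neq_lift _ _)).
  rewrite /weight; apply: eq_bigr => i _; rewrite mulmnE mnmDE mnm_sumE mnm1E.
  rewrite (negPf (neq_lift _ _)) addn0 (bigD1 j) //= mulmnE mnm1E eqxx mul1n.
  rewrite big1 ?addn0 1?mulnC // => k kj; rewrite mulmnE mnm1E.
  by rewrite (inj_eq lift_inj) (negPf kj).
split=> [tt|[eqd eqw]].
  by split=> [|j]; [rewrite -!(tE _).1 tt | rewrite -!(tE _).2 tt].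
apply/mnmP=> j; case: (unliftP ord_max j) => [k ->|->]; first by rewrite !(tE _).2.
by rewrite !(tE _).1.
Qed.

Lemma toric_binomial m1 m2 : toric_ideal K a ('X_[m1] - 'X_[m2]) <-> same_fiber m1 m2.
Proof.
rewrite toric_idealE rmorphB /= !phiX -image_exponentE; split=> [/eqP|->]; last by rewrite
  subrr.
by rewrite subr_eq0 => /eqP /(congr1 (@msupp _ _)); rewrite !msuppX => -[].
Qed.

Definition toric_binomials : set {mpoly K[N]} :=
  fun f => exists m1 m2, [/\ m1 != m2, f = 'X_[m1] - 'X_[m2] & same_fiber m1 m2].

Lemma ideal_span_toric (S : set {mpoly K[N]}) : (forall f, S f -> toric_ideal K a f) ->
  forall f, ideal_span S f -> toric_ideal K a f.
Proof.
move=> SI f [n [g [h [Sh ->]]]]; apply/toric_idealE; rewrite rmorph_sum big1 // => i _.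
by rewrite rmorphM /=; have /toric_idealE-> := SI _ (Sh i); rewrite mulr0.
Qed.

(** The terms of f with a given image cancel, so every monomial m of f has a
    companion m' in its fibre, and subtracting a multiple of X^m - X^m' removes m
    without creating a new monomial. *)
Lemma toric_span f : toric_ideal K a f -> ideal_span toric_binomials f.
Proof.
have [k] := ubnP (size (msupp f)); elim: k f => // k IH f ltk fI.
case: (eqVneq f 0) => [->|f0]; first exact: ideal_span0.
have [m mf] : exists m, m \in msupp f.
  case E: (msupp f) => [|m s]; first by rewrite -msupp_eq0 E in f0.
  by exists m; rewrite mem_head.
have phiE g : phi g = \sum_(u <- msupp g) g@_u *: 'X_[image_exponent u].
  rewrite {1}[g]mpolyE rmorph_sum; apply: eq_bigr => u _ /=.
  by rewrite mmapZ phiX mul_mpolyC.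
have [m' [m'f m'm tm]] : exists m', [/\ m' \in msupp f, m' != m & image_exponent m' =
  image_exponent m].
  apply: contrapT => no; move/toric_idealE: fI; rewrite phiE => /mpolyP/(_ (image_exponent
    m)).
  rewrite mcoeff0 (bigD1_seq m) //= mcoeffD mcoeffZ mcoeffX eqxx mulr1.
  rewrite raddf_sum big_seq_cond big1 ?addr0 => [|u /andP[uf um] /=].
    by move/eqP; rewrite mcoeff_eq0 mf.
  rewrite mcoeffZ mcoeffX; case: eqVneq => [tu|_]; last by rewrite mulr0.
  by case: no; exists u.
pose b : {mpoly K[N]} := 'X_[m] - 'X_[m'].
have bS : toric_binomials b by exists m, m'; rewrite eq_sym; split=> //;
  apply/image_exponentE.
have bI : toric_ideal K a b by apply/toric_binomial/image_exponentE.
rewrite -[f](subrK (f@_m *: b)); apply: ideal_spanD; last first.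
  by rewrite -mul_mpolyC; apply/ideal_spanMl/ideal_span_gen.
apply: IH; last first.
  move/toric_idealE: fI => fI; move/toric_idealE: bI => bI.
  by apply/toric_idealE; rewrite rmorphB /= fI -mul_mpolyC rmorphM /= bI mulr0 subrr.
apply: leq_trans (_ : (size (msupp f) <= k)%N); last by rewrite -ltnS.
have gm : (f - f@_m *: b)@_m = 0.
  by rewrite mcoeffB mcoeffZ mcoeffB !mcoeffX eqxx (negPf m'm) subr0 mulr1 subrr.
rewrite (perm_size (perm_to_rem mf)) /= ltnS uniq_leq_size // => u uf.
rewrite mem_rem_uniq // inE; move: uf; rewrite mcoeff_msupp => uf.
have um : u != m by apply: contraNneq uf => ->; rewrite gm.
rewrite um /=; case: (eqVneq u m') => [->//|um'].
move: uf; rewrite mcoeffB mcoeffZ mcoeffB !mcoeffX ![_ == u]eq_sym (negPf um) (negPf um').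
by rewrite subr0 mulr0 subr0 mcoeff_msupp.
Qed.

Lemma toric_generators S : (forall f, S f -> is_binomial f /\ toric_ideal K a f) ->
  (forall f, toric_binomials f -> ideal_span S f) ->
  binomial_generators (toric_ideal K a) S.
Proof.
move=> SI gen; split=> [f /SI[]//|]; apply/seteqP; split=> f.
  by apply: ideal_span_toric => g /SI[].
by move/toric_span; apply: ideal_span_sub.
Qed.

Lemma same_fiber_sym m1 m2 : same_fiber m1 m2 -> same_fiber m2 m1.
Proof. by case=> eqd eqw; split=> // j; rewrite eqw. Qed.

Lemma same_fiber_trans m1 m2 m3 : same_fiber m1 m2 -> same_fiber m2 m3 -> same_fiber m1 m3.
Proof. by move=> [d1 w1] [d2 w2]; split=> [|j]; rewrite ?d1 // w1 w2. Qed.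

Lemma weightD m1 m2 j : weight (m1 + m2)%MM j = (weight m1 j + weight m2 j)%N.
Proof. by rewrite /weight -big_split; apply: eq_bigr => i _; rewrite mnmDE mulnDl. Qed.

Lemma weightU i j : weight U_(i)%MM j = `|a i 0%R j|%N.
Proof.
rewrite /weight (bigD1 i) //= mnm1E eqxx mul1n big1 ?addn0 // => k ki.
by rewrite mnm1E eq_sym (negPf ki).
Qed.

Lemma same_fiberD u m1 m2 : same_fiber (u + m1)%MM (u + m2)%MM <-> same_fiber m1 m2.
Proof.
split=> [[+ w]|[eqd w]].
  rewrite !mdegD => /addnI eqd; split=> // j; have := w j; rewrite !weightD; exact: addnI.
by split=> [|j]; rewrite ?mdegD ?eqd // !weightD w.
Qed.

End Toric.

(** * Farkas' lemma *)

Section Farkas.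
Variables (F : realFieldType) (n : nat).
Implicit Types (g h x : 'rV[F]_n).

Definition rdot h x : F := \sum_j h 0 j * x 0 j.

Lemma rdotDl g h x : rdot (g + h) x = rdot g x + rdot h x.
Proof. by rewrite -big_split; apply: eq_bigr => j _; rewrite mxE mulrDl. Qed.

Lemma rdotZl (k : F) h x : rdot (k *: h) x = k * rdot h x.
Proof. by rewrite mulr_sumr; apply: eq_bigr => j _; rewrite mxE mulrA. Qed.

Lemma rdotDr h x y : rdot h (x + y) = rdot h x + rdot h y.
Proof. by rewrite -big_split; apply: eq_bigr => j _; rewrite mxE mulrDr. Qed.

Lemma rdotZr (k : F) h x : rdot h (k *: x) = k * rdot h x.
Proof. by rewrite mulr_sumr; apply: eq_bigr => j _; rewrite mxE; ring. Qed.

Lemma rdot_delta h j : rdot h (delta_mx 0 j) = h 0 j.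
Proof.
rewrite /rdot (bigD1 j) //= mxE !eqxx mulr1 big1 ?addr0 // => k kj.
by rewrite mxE (negPf kj) andbF mulr0.
Qed.

(** Induction on the number of generators, after Bartl.  If one of them, G t, cannot
    be left out of the implication, some x violates the implication without it,
    and then [rdot (G t) x < 0].  Composing all forms with the projection along x
    onto the kernel of G t reduces the claim to the other generators. *)
Lemma farkas (T : finType) (G : T -> 'rV[F]_n) (s : seq T) g : uniq s ->
  (forall x, (forall t, t \in s -> 0 <= rdot (G t) x) -> 0 <= rdot g x) ->
  exists2 l : T -> F, forall t, 0 <= l t & g = \sum_(t <- s) l t *: G t.
Proof.
elim: s G g => [|t s IH] G g /=.
  move=> _ pos; exists (fun=> 0) => //; rewrite big_nil; apply/rowP => j; rewrite mxE.
  have p x : 0 <= rdot g x by apply: pos.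
  apply/eqP; rewrite eq_le -{1}oppr_ge0 -rdot_delta p andbT.
  by rewrite -[- _]mulN1r -rdotZr p.
case/andP=> ts us pos.
case: (pselect (forall x, (forall u, u \in s -> 0 <= rdot (G u) x) -> 0 <= rdot g x)) =>
  [/IH|].
  case=> // l l0 ->; exists (fun u => if u == t then 0 else l u) => [u|].
    by case: ifP.
  rewrite big_cons eqxx scale0r add0r; apply: eq_big_seq => u us'.
  by case: eqVneq ts => // <-; rewrite us'.
move=> /existsNP[x /not_implyP[xs /negP]]; rewrite -ltNge => gx.
have Gx : rdot (G t) x < 0.
  rewrite ltNge; apply: contraTN gx => Gx; rewrite -leNgt; apply: pos => u.
  by rewrite inE => /predU1P[->//|/xs].
(* G t takes the value -1 at k x, so it vanishes at y + (k * rdot (G t) y) x. *)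
pose k := - (rdot (G t) x)^-1.
have k0 : 0 < k by rewrite oppr_gt0 invr_lt0.
have kx : k * rdot (G t) x = - 1 by rewrite mulNr mulVf // lt_eqF.
pose proj h := h + (k * rdot h x) *: G t.
have projE h y : rdot (proj h) y = rdot h (y + (k * rdot (G t) y) *: x).
  by rewrite /proj rdotDl rdotZl rdotDr rdotZr; ring.
have [|l l0 gE] := IH (fun u => proj (G u)) (proj g) us.
  move=> y ys; rewrite projE; apply: pos => u; rewrite inE => /predU1P[->|/ys].
    by rewrite rdotDr rdotZr mulrAC kx mulN1r subrr.
  by rewrite projE.
pose c := - (k * rdot g x) + \sum_(u <- s) l u * (k * rdot (G u) x).
exists (fun u => if u == t then c else l u) => [u|].
  case: ifP => // _; apply: addr_ge0.
    by rewrite oppr_ge0 pmulr_rle0 // ltW.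
  rewrite big_seq; apply: sumr_ge0 => v vs; apply: mulr_ge0 => //.
  by apply: mulr_ge0; [exact: ltW | exact: xs].
rewrite big_cons eqxx.
rewrite (eq_big_seq (fun u => l u *: G u)); last first.
  by move=> u us'; case: eqVneq ts => // <-; rewrite us'.
rewrite -[LHS](addrK ((k * rdot g x) *: G t)) -/(proj g) gE /proj scalerDl scaleNr addrC.
rewrite -addrA; congr (_ + _); rewrite scaler_suml -big_split; apply: eq_bigr => u _.
by rewrite scalerDr scalerA addrC.
Qed.

End Farkas.

(** * Faces of 0/1 polytopes *)

Section Faces.
Variables (R : realType) (d : nat).
Implicit Types (A P : set 'rV[R]_d) (c x : 'rV[R]_d).
Local Open Scope classical_set_scope.

Lemma dot_sum c n (w : 'I_n -> R) (p : 'I_n -> 'rV[R]_d) :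
  dot c (\sum_i w i *: p i) = \sum_i w i * dot c (p i).
Proof.
rewrite /dot (eq_bigr (fun j => \sum_i w i * (c 0 j * p i 0 j))) => [|j _].
  by rewrite exchange_big; apply: eq_bigr => i _; rewrite mulr_sumr.
by rewrite summxE mulr_sumr; apply: eq_bigr => i _; rewrite mxE; ring.
Qed.

Lemma sub_conv A : A `<=` conv A.
Proof.
move=> x Ax; exists 1, (fun=> 1), (fun=> x); split=> //; rewrite big_ord1 //.
by rewrite scale1r.
Qed.

Lemma conv_le A c b : (forall y, A y -> dot c y <= b) ->
  forall x, conv A x -> dot c x <= b.
Proof.
move=> Ab x [n [w [p [w0 w1 Ap ->]]]]; rewrite dot_sum -[leRHS]mul1r -w1 mulr_suml.
by apply: ler_sum => i _; apply: ler_wpM2l => //; apply: Ab.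
Qed.

(** A convex combination attains the maximum of a linear form only if all points
    with nonzero weight do. *)
Lemma conv_face A c b : (forall y, A y -> dot c y <= b) ->
  conv A `&` [set x | dot c x = b] = conv (A `&` [set x | dot c x = b]).
Proof.
move=> Ab; apply/seteqP; split=> x; last first.
  move=> [n [w [p [w0 w1 Ap ->]]]]; split.
    by exists n, w, p; split=> // i; case: (Ap i).
  rewrite /= dot_sum -[RHS]mul1r -w1 mulr_suml; apply: eq_bigr => i _.
  by case: (Ap i) => _ /= ->.
move=> [[n [w [p [w0 w1 Ap xE]]]] /= xb].
have tight i : w i != 0 -> dot c (p i) = b.
  move=> wi; have : \sum_i w i * (b - dot c (p i)) = 0.
    rewrite (eq_bigr (fun i => w i * b - w i * dot c (p i))) => [|j _]; last by rewrite
      mulrBr.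
    by rewrite sumrB -mulr_suml w1 mul1r -dot_sum -xE xb subrr.
  move/eqP; rewrite psumr_eq0 => [/allP/(_ i (mem_index_enum _))|j _]; last first.
    by apply: mulr_ge0 => //; rewrite subr_ge0; apply: Ab.
  by rewrite /= mulf_eq0 (negPf wi) /= subr_eq0 => /eqP.
have [k wk] : exists k, w k != 0.
  apply: contrapT => no; have := w1; rewrite big1 => [/esym/eqP|i _]; first by rewrite
    oner_eq0.
  by apply/eqP; apply: contrapT => wi; apply: no; exists i; apply/negP.
exists n, w, (fun i => if w i == 0 then p k else p i); split=> // [i|].
  by case: eqVneq => wi; split=> //=; apply: tight.
by rewrite xE; apply: eq_bigr => i _; case: eqVneq => // ->; rewrite !scale0r.
Qed.

Lemma conv1 (x : 'rV[R]_d) : conv [set x] = [set x].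
Proof.
apply/seteqP; split=> y; last by move=> ->; apply: sub_conv.
move=> [n [w [p [w0 w1 px ->]]]] /=; rewrite (eq_bigr (fun l => w l *: x)) => [|l _].
  by rewrite -scaler_suml w1 scale1r.
by rewrite (px l).
Qed.

Lemma conv_ex A x : conv A x -> exists y, A y.
Proof.
case=> [[|n] [w [p [w0 w1 Ap _]]]]; last by exists (p ord0).
by move/eqP: w1; rewrite big_ord0 eq_sym oner_eq0.
Qed.

Lemma vertices_conv A : vertices (conv A) `<=` A.
Proof.
move=> v [c [b [cb vE]]].
have Ab y : A y -> dot c y <= b by move/sub_conv; apply: cb.
have := conv_face Ab; rewrite -vE => /seteqP[+ _] => /(_ v erefl)/conv_ex[y [Ay yb]].
have : [set v] y by rewrite vE; split=> //; apply: sub_conv.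
by move=> <-.
Qed.

Lemma vertices_face P F v : is_face P F -> F v -> vertices P v -> vertices F v.
Proof.
move=> [c [b [cb FE]]] Fv [c' [b' [cb' vE]]]; exists c', b'; split.
  by move=> x; rewrite FE => -[Px _]; apply: cb'.
apply/seteqP; split=> x /=.
  move=> ->; split=> //; have : [set v] v by [].
  by rewrite vE => -[].
move=> [Fx xb']; have : [set v] x by rewrite vE; split=> //; move: Fx; rewrite FE => -[].
by [].
Qed.

End Faces.

Section ZeroOne.
Variables (R : realType) (d : nat).
Implicit Types (A : set 'rV[R]_d) (b z : 'I_d -> bool) (J : pred 'I_d).
Local Open Scope classical_set_scope.

Definition bits (b : 'I_d -> bool) : 'rV[R]_d := \row_j (b j)%:R.

Lemma bits_inj b b' : bits b = bits b' -> b =1 b'.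
Proof.
move=> bb j; have := congr1 (fun M : 'rV_d => M 0 j) bb; rewrite !mxE.
by move/eqP; rewrite eqr_nat; case: (b j) (b' j) => [] [].
Qed.

(** The linear form that is maximal, among all 0/1 points, exactly on those that
    agree with z on J. *)
Definition cube_form (z : 'I_d -> bool) (J : pred 'I_d) : 'rV[R]_d :=
  \row_j (if J j then if z j then 1 else - 1 else 0).

Definition cube_bound (z : 'I_d -> bool) (J : pred 'I_d) : R :=
  \sum_j (J j && z j)%:R.

Lemma cube_form_le z J b : dot (cube_form z J) (bits b) <= cube_bound z J.
Proof.
apply: ler_sum => j _; rewrite !mxE.
by case: (J j) (z j) (b j) => [] [] []; rewrite /= ?mulr1 ?mulr0 ?lexx ?ler01 // lerN10.
Qed.

Lemma cube_form_eq z (J : pred 'I_d) b :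
  dot (cube_form z J) (bits b) = cube_bound z J <-> {in J, b =1 z}.
Proof.
split=> [/eqP eqb j Jj|bz].
  have : \sum_j ((J j && z j)%:R - cube_form z J 0 j * bits b 0 j) == 0 :> R.
    by rewrite sumrB -/(cube_bound z J) -(eqP eqb) subrr.
  rewrite psumr_eq0 => [/allP/(_ j (mem_index_enum _))|k _]; rewrite !mxE; last first.
    by case: (J k) (z k) (b k) => [] [] []; rewrite /= ?mulr1 ?mulr0 ?subrr ?subr0 ?opprK
      ?add0r ?lexx ?ler01.
  rewrite [J j]Jj /=; case: (z j) (b j) => [] []; rewrite /= ?mulr1 ?mulr0 ?subrr ?subr0
    ?opprK ?add0r ?oner_eq0 //.
apply: eq_bigr => j _; rewrite !mxE; case: (boolP (J j)) => Jj; last by rewrite mul0r.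
by rewrite bz //; case: (z j); rewrite ?mulr1 ?mulr0.
Qed.

Lemma conv_bits A z : (forall x, A x -> exists b, x = bits b) ->
  conv A (bits z) -> A (bits z).
Proof.
move=> A01 Pz; have tz : dot (cube_form z xpredT) (bits z) = cube_bound z xpredT.
  by apply/cube_form_eq.
have [|y [Ay /= yz]] := conv_ex (_ : conv (A `&` [set x | dot (cube_form z xpredT) x =
  cube_bound z xpredT]) (bits z)).
  rewrite -conv_face; first by split.
  by move=> x /A01[b ->]; apply: cube_form_le.
have [b yE] := A01 y Ay; move: yz Ay; rewrite yE => /cube_form_eq bz.
suff -> : bits z = bits b by [].
by apply/rowP=> j; rewrite !mxE bz.
Qed.

End ZeroOne.

Lemma common_denominator (T : finType) (l : T -> rat) : (forall t, 0 <= l t) ->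
  exists (D : nat) (n : T -> nat), (0 < D)%N /\ forall t, l t * D%:R = (n t)%:R.
Proof.
move=> l0; exists (\prod_t `|denq (l t)|)%N.
exists (fun t => `|numq (l t)| * \prod_(u | u != t) `|denq (l u)|)%N; split.
  by apply: prodn_gt0 => t; rewrite absz_gt0 denq_neq0.
move=> t; rewrite (bigD1 t) //= !natrM mulrA; congr (_ * _).
rewrite !natr_absz gtr0_norm ?denq_gt0 // ger0_norm ?numq_ge0 //.
by rewrite -{1}[l t]divq_num_den divfK // intr_eq0 denq_neq0.
Qed.

(** * The toric ideal of the cut polytope *)

Section CutIdeal.
Variables (R : realType) (K : fieldType) (V : finType) (e : rel V).
Hypothesis e_irr : irreflexive e.
Variables (N : nat) (a : 'I_N -> 'rV[int]_#|edge_set e|).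
Hypothesis a_enum : lattice_points (cut_polytope R e) a.
Local Notation E := #|edge_set e|.
Local Notation P := (cut_polytope R e).
Local Notation I := (toric_ideal K a).
Implicit Types (S : {set V}) (m : 'X_{1..N}) (i k : 'I_N) (j : 'I_E).

Definition cut_bits S j : bool := (#|finset.setI S (enum_val j)| == 1)%N.

Lemma cut_vectorE S : cut_vector R e S = bits R (cut_bits S).
Proof. by []. Qed.

Lemma cut_bits_edge p : e p.1 p.2 -> exists j, forall S, cut_bits S j = cut p S.
Proof.
case: p => x y /= xy; have sE : [set x; y]%SET \in edge_set e.
  by apply/imsetP; exists (x, y) => //; rewrite inE.
exists (enum_rank_in sE [set x; y]%SET) => S; rewrite /cut_bits enum_rankK_in //.
by apply: cut_pair; apply: contraTneq xy => ->; rewrite e_irr.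
Qed.

Lemma edge_cut_bits j : exists2 p, e p.1 p.2 & forall S, cut_bits S j = cut p S.
Proof.
have /imsetP[[x y]] := enum_valP j; rewrite inE /= => xy jE.
exists (x, y) => // S; rewrite /cut_bits jE.
by apply: cut_pair; apply: contraTneq xy => ->; rewrite e_irr.
Qed.

Lemma range_cut_vector_bits x : range (cut_vector R e) x -> exists b, x = bits R b.
Proof. by case=> S _ <-; exists (cut_bits S). Qed.

(** A lattice point of the cut polytope is a 0/1 point, hence a vertex of the cube,
    hence one of the cuts that span the polytope. *)
Lemma lattice_point_cut i : exists S, forall j, a i 0 j = (cut_bits S j)%:R.
Proof.
have Pa : P (map_mx intr (a i)) by apply/(a_enum.2 (a i)); exists i.
have A01 := range_cut_vector_bits.
have a01 j : (0 <= a i 0 j <= 1).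
  have dotE (c : R) (x : 'rV[R]_E) : dot (c *: delta_mx 0 j) x = c * x 0 j.
    rewrite /dot (bigD1 j) //= !mxE !eqxx mulr1 big1 ?addr0 // => k kj.
    by rewrite !mxE (negPf kj) andbF mulr0 mul0r.
  have le1 := @conv_le _ _ _ (1 *: delta_mx 0 j) 1 _ _ Pa.
  have le0 := @conv_le _ _ _ ((-1) *: delta_mx 0 j) 0 _ _ Pa.
  rewrite !dotE !mxE mul1r mulN1r oppr_le0 ler0z lerz1 in le1 le0.
  by rewrite le0 ?le1 // => x /A01[b ->]; rewrite dotE mxE ?mul1r ?mulN1r; case: (b j);
    rewrite ?oppr0 ?lexx ?ler01 ?lerN10.
have aE : a i = \row_j (a i 0 j == 1)%:R.
  by apply/rowP=> j; rewrite mxE; have := a01 j; case: (a i 0 j) => [[|[|n]]|n].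
have := @conv_bits R _ _ (fun j => a i 0 j == 1) A01.
have <- : map_mx intr (a i) = bits R (fun j => a i 0 j == 1).
  by apply/rowP=> j; rewrite [in LHS]aE !mxE; case: (_ == _).
move=> /(_ Pa)[S _ SE]; exists S => j.
have := congr1 (fun M : 'rV[R]_E => M 0 j) SE; rewrite !mxE => aS.
by apply/eqP; rewrite -(eqr_int R) -aS -/(cut_bits S j); case: (cut_bits S j); rewrite /=
  eqxx.
Qed.

Lemma cut_lattice_point S : exists i, forall j, a i 0 j = (cut_bits S j)%:R.
Proof.
have /(a_enum.2 _)[i ai] : P (map_mx intr (\row_j (cut_bits S j)%:R : 'rV[int]_E)).
  apply: sub_conv; exists S => //; apply/rowP=> j; rewrite !mxE -/(cut_bits S j).
  by case: (cut_bits S j).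
by exists i => j; rewrite ai mxE.
Qed.

Definition cut_set i : {set V} := projT1 (cid (lattice_point_cut i)).
Definition cut_index S : 'I_N := projT1 (cid (cut_lattice_point S)).

Lemma cut_setE i j : a i 0 j = (cut_bits (cut_set i) j)%:R.
Proof. exact: (projT2 (cid (lattice_point_cut i))). Qed.

Lemma cut_indexE S j : a (cut_index S) 0 j = (cut_bits S j)%:R.
Proof. exact: (projT2 (cid (cut_lattice_point S))). Qed.

Lemma cut_index_eq S i : (forall j, cut_bits S j = cut_bits (cut_set i) j) -> cut_index S = i.
Proof. by move=> Si; apply: a_enum.1; apply/rowP=> j; rewrite cut_indexE cut_setE Si. Qed.

Lemma cut_setK : cancel cut_set cut_index.
Proof. by move=> i; apply: cut_index_eq. Qed.

Lemma lattice_ge0 i j : 0 <= a i 0 j.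
Proof. by rewrite cut_setE ler0n. Qed.

Lemma lattice_abs i j : `|a i 0%R j|%N = cut_bits (cut_set i) j.
Proof. by rewrite cut_setE; case: (cut_bits _ _). Qed.

Definition monomial (s : seq {set V}) : 'X_{1..N} := (\sum_(S <- s) U_(cut_index S))%MM.

Lemma mdeg_monomial s : mdeg (monomial s) = size s.
Proof.
by rewrite /monomial mdeg_sum (eq_bigr (fun=> 1%N)) ?sum1_size // => S _; rewrite mdeg1.
Qed.

Lemma monomial_cat s t : monomial (s ++ t) = (monomial s + monomial t)%MM.
Proof. exact: big_cat. Qed.

Lemma weight_monomial s j : weight a (monomial s) j = count (cut_bits^~ j) s.
Proof.
elim: s => [|S s IH]; first by rewrite /monomial big_nil /weight big1 // => i _; rewrite
  mnm0E.
rewrite /monomial big_cons weightD weightU -/(monomial s) IH /= cut_indexE.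
by case: (cut_bits S j).
Qed.

Lemma monomial_surj m : exists s, m = monomial s.
Proof.
have [n] := ubnP (mdeg m); elim: n m => // n IH m ltm.
case: (pickP (fun i => m i != 0%N)) => [i mi|m0]; last first.
  exists [::]; rewrite /monomial big_nil; apply/mnmP=> i; rewrite mnm0E.
  by apply/eqP; rewrite -[_ == _]negbK m0.
have mE : m = (U_(i) + (m - U_(i)))%MM by rewrite addmC submK // lep1mP.
have [s sE] : exists s, (m - U_(i))%MM = monomial s.
  by apply: IH; move: ltm; rewrite {1}mE mdegD mdeg1.
by exists (cut_set i :: s); rewrite /monomial big_cons -/(monomial s) -sE cut_setK.
Qed.

Lemma agree_same_fiber s t :
  agree (@cut V) (induced e finset.setT) s t <-> same_fiber a (monomial s) (monomial t).
Proof.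
split=> [[sz ct]|].
  split=> [|j]; rewrite ?mdeg_monomial // !weight_monomial.
  have [p pe jp] := edge_cut_bits j; rewrite !(eq_count jp); apply: ct.
  by rewrite inE pe !finset.in_setT.
case; rewrite !mdeg_monomial => sz w; split=> // p; rewrite inE => /andP[/cut_bits_edge[j
  jp] _].
by have := w j; rewrite !weight_monomial !(eq_count jp).
Qed.
Definition quadrics : set {mpoly K[N]} :=
  fun f => exists m1 m2, [/\ m1 != m2, f = 'X_[m1] - 'X_[m2], same_fiber a m1 m2 & mdeg m1
    = 2].

(** Each move contributes a multiple of a quadratic binomial, and a sequence of
    moves a telescoping sum of them.  Exchanging a single cut changes nothing,
    since a cut is determined by its edges. *)
Lemma fiber_conn_quadrics s t : fiber_conn (@cut V) (induced e finset.setT) s t ->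
  ideal_span quadrics ('X_[monomial s] - 'X_[monomial t]).
Proof.
elim=> [{}s {}t st|A B C szA AB|s1 t1 r _ IH1 _ IH2].
- by rewrite /monomial (perm_big _ st) subrr; apply: ideal_span0.
- rewrite !monomial_cat !mpolyXD -mulrBl mulrC; apply: ideal_spanMl.
  case: (eqVneq (monomial A) (monomial B)) => [->|nAB]; first by rewrite subrr; apply:
    ideal_span0.
  apply: ideal_span_gen; exists (monomial A), (monomial B); split=> //.
    exact/agree_same_fiber.
  rewrite mdeg_monomial; apply/eqP; rewrite eqn_leq szA ltnNge; apply: contra nAB => szA1.
  case: AB => sz ct; case: A szA1 sz ct {szA} => [|S [|//]] _; first by case: B.
  case: B => [//|T [|//]] _ ct; rewrite /monomial !big_seq1; apply/eqP; congr U_(_)%MM.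
  apply: a_enum.1; apply/rowP=> j; rewrite !cut_indexE.
  have [p pe jp] := edge_cut_bits j; rewrite !jp; have := ct p.
  rewrite inE pe !finset.in_setT => /(_ isT) /=; rewrite !addn0.
  by case: (cut p S) (cut p T) => [] [].
- by rewrite -[X in ideal_span _ X](subrKA 'X_[monomial t1]); apply: ideal_spanD.
Qed.

Lemma quadratic_of_fibers_connected : fibers_connected (@cut V) (induced e finset.setT) ->
  quadratic I.
Proof.
move=> q; exists quadrics.
  apply: (toric_generators lattice_ge0) => f.
    case=> m1 [m2 [nm -> sf _]]; split; first by exists m1, m2.
    exact/(toric_binomial _ lattice_ge0).
  case=> m1 [m2 [nm -> sf]].
  have [s sE] := monomial_surj m1; have [t tE] := monomial_surj m2.
  by rewrite sE tE; apply/fiber_conn_quadrics/q/agree_same_fiber; rewrite -sE -tE.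
move=> f [m1 [m2 [nm -> [sf _] dm]]].
by rewrite rpredB // dhomogX /= -?sf dm.
Qed.

Local Open Scope classical_set_scope.

Definition point i : 'rV[R]_E := map_mx intr (a i).

Lemma pointE i : point i = bits R (cut_bits (cut_set i)).
Proof. by apply/rowP=> j; rewrite !mxE cut_setE; case: (cut_bits _ _). Qed.

Lemma point_cut_vector S : point (cut_index S) = cut_vector R e S.
Proof. by apply/rowP=> j; rewrite cut_vectorE !mxE cut_indexE; case: (cut_bits _ _). Qed.

Lemma point_range i : range (cut_vector R e) (point i).
Proof. by exists (cut_set i) => //; rewrite pointE. Qed.

Lemma point_in i : P (point i).
Proof. exact/sub_conv/point_range. Qed.

Lemma cut_bits_inj i k : cut_bits (cut_set i) =1 cut_bits (cut_set k) -> i = k.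
Proof. by move=> ik; rewrite -[i]cut_setK; apply: cut_index_eq. Qed.

Lemma point_inj : injective point.
Proof. by move=> i k; rewrite !pointE => /bits_inj/cut_bits_inj. Qed.

Lemma vertex_point x : vertices P x -> exists i, x = point i.
Proof. by move/vertices_conv => [S _ <-]; exists (cut_index S); rewrite point_cut_vector. Qed.

Lemma mdeg2_split m : mdeg m = 2 -> exists i k, m = (U_(i) + U_(k))%MM.
Proof.
move=> dm; have [s sE] := monomial_surj m.
move: dm; rewrite sE mdeg_monomial; case: s sE => [|S [|T [|//]]] // _ _.
by exists (cut_index S), (cut_index T); rewrite /monomial !big_cons big_nil addm0.
Qed.

Lemma weight2 i k j : weight a (U_(i) + U_(k))%MM j = (cut_bits (cut_set i) j + cut_bits
  (cut_set k) j)%N.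
Proof. by rewrite weightD !weightU !lattice_abs. Qed.

(** On the edge joining i to k the supporting linear form takes its maximum; if i'
    and k' have the same sum, they also lie on this edge, and the only 0/1 points
    there are its ends. *)
Lemma clique_fiber2 (C : set 'rV[R]_E) i k i' k' : skeleton_clique P C -> C (point i) -> C
  (point k) ->
  same_fiber a (U_(i) + U_(k)) (U_(i') + U_(k')) -> (U_(i) + U_(k))%MM = (U_(i') +
    U_(k'))%MM :> 'X_{1..N}.
Proof.
move=> [Cv Cadj] Ci Ck [_ sum2].
have {}sum2 j := sum2 j; have {sum2}sum2 j : (cut_bits (cut_set i) j + cut_bits (cut_set k)
  j =
    cut_bits (cut_set i') j + cut_bits (cut_set k') j)%N by rewrite -!weight2.
case: (eqVneq i k) => [ik|nik].
  subst k; have [-> ->] : i' = i /\ k' = i; last by [].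
  by split; apply: cut_bits_inj => j; have := sum2 j;
    case: (cut_bits _ j) (cut_bits _ j) (cut_bits _ j) => [] [] [].
have [//|//||_ _ _ [c [b [cb fE]]]] := Cadj (point i) (point k).
  by move/point_inj/eqP; rewrite (negPf nik).
have tight x : conv [set point i; point k] x -> dot c x = b by rewrite fE => -[].
have ti := tight _ (sub_conv (or_introl erefl)); have tk := tight _ (sub_conv (or_intror
  erefl)).
have dots : dot c (point i) + dot c (point k) = dot c (point i') + dot c (point k').
  rewrite /dot -!big_split; apply: eq_bigr => j _ /=; rewrite -!mulrDr; congr (_ * _).
  by rewrite !pointE !mxE -!natrD sum2.
have seg01 y : [set point i; point k] y -> exists b, y = bits R b.
  by case=> ->; rewrite pointE; [exists (cut_bits (cut_set i)) | exists (cut_bits (cut_set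
    k))].
have ends x : dot c (point x) = b -> x = i \/ x = k.
  move=> xb; have : conv [set point i; point k] (point x) by rewrite fE; split=> //; apply:
    point_in.
  rewrite [point x]pointE => xc; have := conv_bits seg01 xc; rewrite -pointE.
  by case=> /point_inj; [left | right].
have bi := cb _ (point_in i'); have bk := cb _ (point_in k').
have ii' : i' = i \/ i' = k by apply: ends; move: dots; rewrite ti tk; lra.
have kk' : k' = i \/ k' = k by apply: ends; move: dots; rewrite ti tk; lra.
case: ii' kk' sum2 => -> [] -> sum2 //.
- by case/eqP: nik; apply: cut_bits_inj => j; have := sum2 j; case: (cut_bits _ _)
  (cut_bits _ _) => [] [].
- by rewrite addmC.
- by case/eqP: nik; apply: cut_bits_inj => j; have := sum2 j; case: (cut_bits _ _)
  (cut_bits _ _) => [] [].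
Qed.

Lemma eval_supported (C : pred 'I_N) m :
  'X_[m].@[fun i => (C i)%:R] = [forall i, (m i != 0%N) ==> C i]%:R :> K.
Proof.
rewrite mevalX; case: (boolP [forall i, _]) => [/forallP mC|].
  rewrite big1 // => i _; have := mC i; case: (eqVneq (m i) 0%N) => [-> _|_ /= ->]; first
    exact: expr0.
  by rewrite expr1n.
by case/forallPn=> i; rewrite negb_imply => /andP[mi /negbTE Ci]; rewrite (bigD1 i) //= Ci
  expr0n (negPf mi) mul0r.
Qed.

(** Evaluation at the indicator of C kills the quadratic generators: by
    [clique_fiber2] neither monomial of a generator is supported on C. *)
Lemma clique_fiber (C : set 'rV[R]_E) m1 m2 : quadratic I -> skeleton_clique P C ->
  same_fiber a m1 m2 -> (forall i, m1 i != 0%N -> C (point i)) ->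
  forall i, m2 i != 0%N -> C (point i).
Proof.
move=> [S [Sbin SI] Shom] Ccl sf m1C.
(* The point of evaluation is the indicator function of C. *)
pose D := [pred i | `[< C (point i) >]].
pose ev : {mpoly K[N]} -> K := meval (fun i => (D i)%:R).
have ev0 h : S h -> ev h = 0.
  move=> Sh; have hI : I h by rewrite -SI; apply: ideal_span_gen.
  have [u1 [u2 [nu hE]]] := Sbin h Sh; have hom := Shom h Sh.
  have du1 : mdeg u1 = 2 by apply: (dhomogP _ _ _ hom); rewrite hE msupp_binomial // eqxx.
  have du2 : mdeg u2 = 2 by apply: (dhomogP _ _ _ hom); rewrite hE msupp_binomial // eqxx
    orbT.
  have sfu : same_fiber a u1 u2 by apply/(toric_binomial K lattice_ge0); rewrite -hE.
  have out v1 v2 : mdeg v1 = 2 -> mdeg v2 = 2 -> same_fiber a v1 v2 -> v1 != v2 ->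
      [forall i, (v1 i != 0%N) ==> D i] = false.
    move=> /mdeg2_split[i [k ->]] /mdeg2_split[i' [k' ->]] sfv; apply: contraNF => /forallP
      vD.
    have CP x : (U_(i) + U_(k))%MM x != 0%N -> C (point x) by move=> vx; have := vD x;
      rewrite vx => /asboolP.
    apply/eqP; apply: (clique_fiber2 Ccl) sfv; apply: CP; rewrite mnmDE !mnm1E eqxx ?addn1 //.
  rewrite hE /ev mevalB !eval_supported (out u1 u2) // (out u2 u1) ?subrr //; last by
    rewrite eq_sym.
  exact: same_fiber_sym.
have : I ('X_[m1] - 'X_[m2]) by apply/(toric_binomial K lattice_ge0).
rewrite -SI => -[n [g [h [Sh bE]]]] i m2i.
have := congr1 ev bE; rewrite {2}/ev raddf_sum /= big1 => [|k _]; last first.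
  by rewrite mevalM; have := ev0 _ (Sh k); rewrite /ev => ->; rewrite mulr0.
rewrite /ev mevalB !eval_supported.
rewrite (_ : [forall i, (m1 i != 0%N) ==> D i]); last first.
  by apply/forallP=> x; apply/implyP=> /m1C /asboolP.
case: (boolP [forall i, (m2 i != 0%N) ==> D i]) => [/forallP/(_ i)|_].
  by rewrite m2i => /asboolP.
by move/eqP; rewrite subr0 oner_eq0.
Qed.

(** The extra coordinate 1 turns affine functions into linear ones, and makes
    relations respect the degree. *)
Definition homogenized i : 'rV[rat]_(1 + E) := row_mx (const_mx 1) (map_mx intr (a i)).

Lemma homogenized0 i : homogenized i 0 (lshift _ 0) = 1.
Proof. by rewrite row_mxEl mxE. Qed.

Lemma homogenizedS i j : homogenized i 0 (rshift _ j) = `|a i 0%R j|%N%:R.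
Proof. by rewrite row_mxEr mxE lattice_abs cut_setE; case: (cut_bits _ _). Qed.

(** Otherwise Farkas' lemma expresses v by nonnegative combinations: v + (a
    combination of lattice points) = (a combination of points of C).  Clearing
    denominators gives two monomials of the same fibre, of which only one is
    supported on C. *)
Lemma separate_point (C : pred 'I_N) v :
  (forall m1 m2, same_fiber a m1 m2 -> (forall i, m1 i != 0%N -> C i) ->
     forall i, m2 i != 0%N -> C i) ->
  ~~ C v -> exists x, [/\ forall i, rdot (homogenized i) x <= 0,
     forall i, C i -> rdot (homogenized i) x = 0 & rdot (homogenized v) x < 0].
Proof.
move=> Cfib Cv; apply: contrapT => no.
pose G (t : 'I_N * bool) := if t.2 then - homogenized t.1 else if C t.1 then homogenized
  t.1 else 0.
have rdotN h (x : 'rV[rat]_(1 + E)) : rdot (- h) x = - rdot h x.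
  by rewrite -scaleN1r rdotZl mulN1r.
have [||l l0 vE] := @farkas _ _ _ G (index_enum _) (homogenized v).
- exact: index_enum_uniq.
- move=> x Gx; rewrite leNgt; apply/negP=> vx; apply: no; exists x.
  have neg i : rdot (homogenized i) x <= 0.
    by rewrite -oppr_ge0 -rdotN; apply: (Gx (i, true)); apply: mem_index_enum.
  split=> // i Ci; apply/eqP; rewrite eq_le neg /=.
  by have := Gx (i, false) (mem_index_enum _); rewrite /G /= Ci.
have [D [n [D0 nE]]] := common_denominator l0.
pose m1 : 'X_{1..N} := [multinom (if C i then n (i, false) else 0%N) | i < N].
pose m2 : 'X_{1..N} := [multinom ((i == v) * D + n (i, true))%N | i < N].
have key (q : 'I_(1 + E)) : \sum_i (m1 i)%:R * homogenized i 0 q = \sum_i (m2 i)%:R *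
  homogenized i 0 q.
  have : D%:R * homogenized v 0 q = \sum_i ((m1 i)%:R - (n (i, true))%:R) * homogenized i 0 q.
    rewrite {1}vE summxE mulr_sumr.
    rewrite (eq_bigr (fun p : 'I_N * bool => D%:R * (l (p.1, p.2) *: G (p.1, p.2)) 0 q)) =>
      [|[]//].
    rewrite -(pair_bigA _ (fun i b => D%:R * (l (i, b) *: G (i, b)) 0 q)) /=.
    apply: eq_bigr => i _; rewrite big_bool /G /= mnmE -!nE; move: (homogenized i) => h.
    by case: (C i); rewrite !mxE -?nE; ring.
  rewrite (eq_bigr (fun i => (m1 i)%:R * homogenized i 0 q - (n (i, true))%:R * homogenized
    i 0 q)) => [|i _]; last by rewrite mulrBl.
  rewrite sumrB => /eqP; rewrite eq_sym subr_eq => /eqP->.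
  rewrite [RHS](eq_bigr (fun i => ((i == v) * D)%:R * homogenized i 0 q + (n (i, true))%:R
    * homogenized i 0 q)) => [|i _]; last by rewrite /m2 mnmE natrD mulrDl.
  rewrite [RHS]big_split /=; congr (_ + _); rewrite (bigD1 v) //= eqxx mul1n big1 ?addr0 //
    => i iv.
  by rewrite (negPf iv) mul0r.
have sf : same_fiber a m1 m2.
  have sum0 m : \sum_i (m i)%:R * homogenized i 0 (lshift _ 0) = (mdeg m)%:R.
    by rewrite mdegE natr_sum; apply: eq_bigr => i _; rewrite homogenized0 mulr1.
  have sumS m j : \sum_i (m i)%:R * homogenized i 0 (rshift _ j) = (weight a m j)%:R.
    by rewrite natr_sum; apply: eq_bigr => i _; rewrite homogenizedS natrM.
  by split=> [|j]; apply/eqP; rewrite -(eqr_nat rat) -?sum0 -?sumS key.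
have /negP := Cv; apply; apply: (Cfib m1 m2 sf) => [i|].
  by rewrite mnmE; case: (C i).
by rewrite mnmE eqxx mul1n addn_eq0 negb_and -lt0n D0.
Qed.

(** The sum of the functionals of [separate_point] over all v outside C cuts out
    exactly C. *)
Lemma clique_face_of_quadratic : quadratic I -> clique_face_property P.
Proof.
move=> quadI C Ccl; have [Cv _] := Ccl.
pose D := [pred i | `[< C (point i) >]].
have Dfib m1 m2 : same_fiber a m1 m2 -> (forall i, m1 i != 0%N -> D i) -> forall i, m2 i !=
  0%N -> D i.
  move=> sf m1D i m2i; apply/asboolP; apply: (clique_fiber quadI Ccl sf) m2i => k /m1D.
  by move/asboolP.
have /choice[x xP] : forall v, exists x, ~~ D v -> [/\ forall i, rdot (homogenized i) x <= 0,
     forall i, D i -> rdot (homogenized i) x = 0 & rdot (homogenized v) x < 0].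
  move=> v; case: (boolP (D v)) => [_|Dv]; first by exists 0.
  by have [x xP] := separate_point Dfib Dv; exists x.
pose y : 'rV[rat]_(1 + E) := \sum_(v | ~~ D v) x v.
have yE i : rdot (homogenized i) y = \sum_(v | ~~ D v) rdot (homogenized i) (x v).
  apply: (big_morph (rdot (homogenized i))); first by move=> ? ?; rewrite rdotDr.
  by rewrite /rdot big1 // => j _; rewrite [X in _ * X]mxE mulr0.
have yle i : rdot (homogenized i) y <= 0.
  by rewrite yE; apply: sumr_le0 => v Dv; case: (xP v Dv).
have yeq i : rdot (homogenized i) y = 0 <-> C (point i).
  split=> [yi|Ci].
    apply: contrapT => nCi; have Di : ~~ D i by apply/asboolPn.
    move: yi; rewrite yE (bigD1 i) //= => /eqP; apply/negP.
    rewrite lt_eqF // -[ltRHS]addr0; have [_ _ lt] := xP i Di; apply: ltr_leD => //.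
    by apply: sumr_le0 => v /andP[Dv _]; case: (xP v Dv).
  by rewrite yE big1 // => v Dv; have [_ + _] := xP v Dv; apply; apply/asboolP.
pose c : 'rV[R]_E := \row_j ratr (y 0 (rshift _ j)).
pose b : R := - ratr (y 0 (lshift _ 0)).
have cE i : dot c (point i) = b + ratr (rdot (homogenized i) y).
  rewrite /rdot big_split_ord big_ord1 homogenized0 mul1r rmorphD /= addrA addNr add0r.
  rewrite rmorph_sum; apply: eq_bigr => j _; rewrite rmorphM /= row_mxEr [RHS]mulrC.
  by rewrite [c 0 j]mxE /point ![(map_mx _ _) 0 j]mxE ratr_int.
have Ab z : range (cut_vector R e) z -> dot c z <= b.
  case=> S _ <-; rewrite -point_cut_vector cE gerDl.
  by have := yle (cut_index S); rewrite -(ler_rat R) rmorph0.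
have tight i : dot c (point i) = b <-> C (point i).
  rewrite cE -yeq; split=> [/eqP|->]; last by rewrite rmorph0 addr0.
  by rewrite -subr_eq0 addrAC subrr add0r fmorph_eq0 => /eqP.
have faceF : is_face P (P `&` [set z | dot c z = b]).
  by exists c, b; split=> // z; apply: conv_le.
exists (P `&` [set z | dot c z = b]) => //; apply/seteqP; split=> z.
  rewrite conv_face // => /vertices_conv[[S _ <-]].
  by rewrite -point_cut_vector /= => /tight.
move=> Cz; have vz := Cv z Cz; have [i zi] := vertex_point vz.
apply: (vertices_face faceF) => //; rewrite zi in Cz *; split; first exact: point_in.
exact/tight.
Qed.

Lemma cut_face c b : (forall S, dot c (cut_vector R e S) <= b) ->
  is_face P (conv (range (cut_vector R e) `&` [set x | dot c x = b])).
Proof.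
move=> cb; have Ab z : range (cut_vector R e) z -> dot c z <= b by case=> S _ <-.
by exists c, b; split; [exact: conv_le | rewrite conv_face].
Qed.

Lemma cube_face (J : pred 'I_E) z :
  is_face P (conv (range (cut_vector R e) `&`
    [set x | dot (cube_form R z J) x = cube_bound R z J])).
Proof. by apply: cut_face => S; apply: cube_form_le. Qed.

Lemma vertex_of_point i : vertices P (point i).
Proof.
have := cube_face xpredT (cut_bits (cut_set i)).
rewrite (_ : _ `&` _ = [set point i]) ?conv1 //; apply/seteqP; split=> x /=.
  move=> [[S _ <-] /cube_form_eq Si]; rewrite pointE; apply/rowP=> j.
  by have Sij : cut_bits S j = cut_bits (cut_set i) j := Si j isT; rewrite !mxE -Sij.
move=> ->; split; first exact: point_range.
by rewrite pointE; apply/cube_form_eq.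
Qed.

Definition symdiff3 (S T U : {set V}) : {set V} :=
  [set v | (v \in S) (+) (v \in T) (+) (v \in U)]%SET.

Lemma cut_bits_symdiff3 S T U j :
  cut_bits (symdiff3 S T U) j = cut_bits S j (+) cut_bits T j (+) cut_bits U j.
Proof.
have [p _ jp] := edge_cut_bits j; rewrite !jp /cut !inE.
by do 6!case: (_ \in _).
Qed.

Lemma cut_index_abs S j : `|a (cut_index S) 0%R j|%N = cut_bits S j.
Proof. by rewrite cut_indexE; case: (cut_bits _ _). Qed.

(** A cut S in the smallest face of the cube containing i and k has the partner
    T = S + i + k modulo 2, with S + T = i + k as integer vectors. *)
Lemma point_edge i k :
  (forall i' k', same_fiber a (U_(i) + U_(k)) (U_(i') + U_(k')) ->
     (U_(i) + U_(k))%MM = (U_(i') + U_(k'))%MM :> 'X_{1..N}) ->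
  is_face P (conv [set point i; point k]).
Proof.
move=> only; pose J := [pred j | cut_bits (cut_set i) j == cut_bits (cut_set k) j].
have := cube_face J (cut_bits (cut_set i)).
rewrite (_ : _ `&` _ = [set point i; point k]) //; apply/seteqP; split=> x /=.
  move=> [[S _ <-] /cube_form_eq Si].
  pose T := symdiff3 S (cut_set i) (cut_set k).
  have /mnmP/(_ (cut_index S)) : (U_(i) + U_(k))%MM = (U_(cut_index S) + U_(cut_index
    T))%MM :> 'X_{1..N}.
    apply: only; split=> [|j]; first by rewrite !mdegD !mdeg1.
    rewrite !weightD !weightU !cut_index_abs !lattice_abs cut_bits_symdiff3.
    have := Si j; rewrite inE /=.
    rewrite -/(cut_bits S j).
    by case: (cut_bits (cut_set i) j) (cut_bits (cut_set k) j) (cut_bits S j) => [] [] []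
      // /(_ isT).
  rewrite !mnmDE !mnm1E eqxx -point_cut_vector.
  by case: (eqVneq i (cut_index S)) => [->|_]; [left | case: (eqVneq k (cut_index S)) =>
    [->|//]; right].
case=> ->; (split; first exact: point_range); rewrite pointE; apply/cube_form_eq => // j.
by rewrite inE => /eqP.
Qed.

Lemma generators_toric_binomials : binomial_generators I (@toric_binomials K _ _ a).
Proof.
apply: (toric_generators lattice_ge0) => f; last exact: ideal_span_gen.
case=> m1 [m2 [nm -> sf]]; split; first by exists m1, m2.
exact/(toric_binomial _ lattice_ge0).
Qed.

Lemma indispensable_monomial_move m : indispensable_monomial I m ->
  exists2 m', m' != m & same_fiber a m m'.
Proof.
move=> /(_ _ generators_toric_binomials)[f [m1 [m2 [nm -> sf]]]].
rewrite msupp_binomial // => /orP[]/eqP->; first by exists m2; rewrite // eq_sym.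
by exists m1; last exact: same_fiber_sym.
Qed.

(** If m = u + m1 with X^m1 - X^m1' in the ideal, every binomial X^m - X^n is the
    sum of X^u (X^m1 - X^m1') and of X^(u + m1') - X^n, so that the ideal is
    generated by binomials in which m does not occur. *)
Lemma indispensable_monomial_minimal m : indispensable_monomial I m ->
  forall u m1 m1', m = (u + m1)%MM -> u != 0%MM -> same_fiber a m1 m1' -> m1 = m1'.
Proof.
move=> ind u m1 m1' mE u0 sf1; apply/eqP; apply: contrapT => /negP nm1.
pose S : set {mpoly K[N]} := fun f => exists n1 n2,
  [/\ [/\ n1 != n2, n1 != m & n2 != m], f = 'X_[n1] - 'X_[n2] & same_fiber a n1 n2].
have mdu : (0 < mdeg u)%N by rewrite lt0n mdeg_eq0.
have deg_m n : mdeg n = mdeg m1 -> n != m.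
  by move=> dn; apply/eqP=> nE; move: dn; rewrite nE mE mdegD; lia.
have spanm n : n != m -> same_fiber a m n -> ideal_span S ('X_[m] - 'X_[n]).
  move=> nm sfn; pose r := (u + m1')%MM.
  have rm : r != m by rewrite mE (inj_eq (@addmI _ u)) eq_sym.
  have sfr : same_fiber a r n.
    by apply: same_fiber_trans sfn; rewrite mE; apply/same_fiberD/same_fiber_sym.
  have -> : 'X_[m] - 'X_[n] = 'X_[u] * ('X_[m1] - 'X_[m1']) + ('X_[r] - 'X_[n]) :> {mpoly
    K[N]}.
    by rewrite mulrBr -!mpolyXD -mE subrKA.
  apply: ideal_spanD.
    apply/ideal_spanMl/ideal_span_gen; exists m1, m1'; split=> //.
    by split=> //; apply: deg_m; case: sf1.
  case: (eqVneq r n) => [->|rn]; first by rewrite subrr; apply: ideal_span0.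
  by apply: ideal_span_gen; exists r, n.
have Sgen : binomial_generators I S.
  apply: (toric_generators lattice_ge0) => f.
    case=> n1 [n2 [[nn _ _] -> sf]]; split; first by exists n1, n2.
    exact/(toric_binomial _ lattice_ge0).
  case=> n1 [n2 [nn -> sf]].
  case: (eqVneq n1 m) => [n1m|n1m]; first by rewrite n1m in nn sf *; apply: spanm; rewrite
    // eq_sym.
  case: (eqVneq n2 m) => [n2m|n2m].
    rewrite n2m in nn sf *; rewrite -opprB -mulN1r; apply: ideal_spanMl.
    by apply: spanm => //; apply: same_fiber_sym.
  by apply: ideal_span_gen; exists n1, n2.
have [f [n1 [n2 [[nn n1m n2m] -> _]]]] := ind S Sgen.
by rewrite msupp_binomial // ![m == _]eq_sym (negPf n1m) (negPf n2m).
Qed.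

(** A linear form has the same sum over all monomials of a fibre. *)
Lemma dot_fiber c m : \sum_i (m i)%:R * dot c (point i) = \sum_j c 0 j * (weight a m j)%:R.
Proof.
rewrite /dot (eq_bigr (fun i => \sum_j c 0 j * (m i * `|a i 0%R j|)%:R)) => [|i _].
  by rewrite exchange_big; apply: eq_bigr => j _; rewrite -mulr_sumr natr_sum.
rewrite mulr_sumr; apply: eq_bigr => j _; rewrite pointE !mxE natrM lattice_abs.
by ring.
Qed.

Lemma no_indispensable_monomial : clique_face_property P ->
  ~ (exists m : 'X_{1..N}, indispensable_monomial I m /\ (3 <= mdeg m)%N).
Proof.
move=> cfp [m [ind m3]].
have mini := indispensable_monomial_minimal ind.
have [m' m'm sf] := indispensable_monomial_move ind.
pose C : set 'rV[R]_E := [set x | exists2 i, m i != 0%N & x = point i].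
have Ccl : skeleton_clique P C.
  split=> [x [i _ ->]|x y [i mi ->] [k mk ->] ik]; first exact: vertex_of_point.
  split; [exact: vertex_of_point | exact: vertex_of_point | exact: ik |].
  have nik : i != k by apply: contra_notN ik => /eqP->.
  apply: point_edge => i' k' sf2.
  have le2 : (U_(i) + U_(k) <= m)%MM.
    apply/mnm_lepP=> q; rewrite mnmDE !mnm1E.
    case: (eqVneq i q) => [iq|_]; case: (eqVneq k q) => [kq|_] //=; rewrite ?lt0n -?iq -?kq
      //.
    by rewrite iq kq eqxx in nik.
  apply: (mini (m - (U_(i) + U_(k)))%MM) => //; first by rewrite submK.
  rewrite -mdeg_eq0 -lt0n; have := congr1 mdeg (submK le2).
  by rewrite !mdegD !mdeg1; lia.
have [F Fface FC] := cfp C Ccl.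
have [c [b [cb FE]]] := Fface.
have tight i : m i != 0%N -> dot c (point i) = b.
  move=> mi; have : C (point i) by exists i.
  rewrite -FC => -[c' [b' [_ vE]]]; have : [set point i] (point i) by [].
  by rewrite vE => -[]; rewrite FE => -[].
have m'C i : m' i != 0%N -> m i != 0%N.
  move=> m'i; have : \sum_k (m' k)%:R * (b - dot c (point k)) = 0.
    rewrite (eq_bigr (fun k => (m' k)%:R * b - (m' k)%:R * dot c (point k))) => [|k _];
      last by rewrite mulrBr.
    rewrite sumrB dot_fiber; have [eqd eqw] := sf.
    under [X in _ - X]eq_bigr do rewrite -eqw.
    rewrite -dot_fiber -mulr_suml -natr_sum -mdegE -eqd mdegE natr_sum mulr_suml -sumrB
      big1 // => k _.
    by rewrite -mulrBr; case: (eqVneq (m k) 0%N) => [->|/tight->]; rewrite ?mul0r // subrr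
      mulr0.
  move/eqP; rewrite psumr_eq0 => [/allP/(_ i (mem_index_enum _))|k _]; last first.
    by rewrite mulr_ge0 // subr_ge0 cb //; apply: point_in.
  rewrite /= mulf_eq0 pnatr_eq0 (negPf m'i) subr_eq0 => /eqP bi.
  have : vertices F (point i).
    apply: vertices_face Fface _ (vertex_of_point i).
    by rewrite FE; split; first exact: point_in.
  by rewrite FC => -[k mk /point_inj ->].
have [i m'i] : exists i, m' i != 0%N.
  apply: contrapT => no; have m'0 : m' = 0%MM.
    by apply/mnmP=> i; rewrite mnm0E; apply/eqP; apply: contrapT => /negP m'i; apply: no;
      exists i.
  by have [+ _] := sf; rewrite m'0 mdeg0; lia.
have mi := m'C i m'i.
have le1 : (U_(i) <= m)%MM by rewrite lep1mP.
have le1' : (U_(i) <= m')%MM by rewrite lep1mP.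
have mE : m = (U_(i) + (m - U_(i)))%MM by rewrite addmC submK.
have m'E : m' = (U_(i) + (m' - U_(i)))%MM by rewrite addmC submK.
have : (m - U_(i))%MM = (m' - U_(i))%MM.
  apply: (mini U_(i)%MM) => //; first by rewrite -mdeg_eq0 mdeg1.
  by apply/(same_fiberD a U_(i)%MM); rewrite -mE -m'E.
by move=> E'; case/eqP: m'm; rewrite mE m'E E'.
Qed.

Lemma no_indispensable_binomial :
  ~ (exists m : 'X_{1..N}, indispensable_monomial I m /\ (3 <= mdeg m)%N) ->
  ~ (exists f : {mpoly K[N]}, indispensable_binomial I f /\ (3 <= (msize f).-1)%N).
Proof.
move=> no [f [[fI [m1 [m2 [nm fE]]] ind] deg]]; apply: no; exists m1; split.
  move=> S /ind[Sf|Sf]; [exists f | exists (- f)]; rewrite // ?fE ?opprB msupp_binomial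
    ?eqxx ?orbT //.
  by rewrite eq_sym.
have [dm _] : same_fiber a m1 m2 by apply/(toric_binomial K lattice_ge0); rewrite -fE.
suff : (msize f <= (mdeg m1).+1)%N by move: deg; lia.
rewrite msizeE; apply/bigmax_leqP_seq => m; rewrite fE msupp_binomial // => /orP[]/eqP-> _ //.
by rewrite -dm.
Qed.

(** X^m1 - X^m2 is a combination of generators, one of which has a monomial that
    divides m1.  Multiplied by the cofactor, its other monomial lands in the
    fibre, hence is m2; as m1 and m2 are coprime, the cofactor is 1. *)
Lemma indispensable_of_fiber m1 m2 : m1 != m2 -> same_fiber a m1 m2 ->
  (forall m, same_fiber a m1 m -> m = m1 \/ m = m2) ->
  (forall i, m1 i != 0%N -> m2 i = 0%N) ->
  indispensable_binomial I ('X_[m1] - 'X_[m2]).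
Proof.
move=> nm sf fib disj; split; first exact/(toric_binomial _ lattice_ge0).
  by exists m1, m2.
move=> S [Sbin SI].
have : I ('X_[m1] - 'X_[m2]) by apply/(toric_binomial _ lattice_ge0).
rewrite -SI => -[n [g [h [Sh fE]]]].
have [l] : exists l, m1 \in msupp (g l * h l).
  apply: contrapT => no; have := congr1 (mcoeff m1) fE.
  rewrite raddf_sum /= big1 => [|l _].
    by move/eqP; rewrite mcoeff_eq0 msupp_binomial // eqxx.
  by apply/eqP; rewrite mcoeff_eq0; apply/negP=> ml; apply: no; exists l.
move/msuppM_le/allpairsP=> [[w u] /= [_ uh m1E]].
have hS := Sh l; have hI : I (h l) by rewrite -SI; apply: ideal_span_gen.
have swap v v' : m1 = (w + v)%MM -> v != v' -> same_fiber a v v' -> v = m1 /\ v' = m2.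
  move=> mE nv sfv; have [|wE|wE] := fib (w + v')%MM.
  - by rewrite mE; apply/same_fiberD.
  - by case/eqP: nv; apply: (@addmI _ w); rewrite -mE wE.
  suff w0 : w = 0%MM by rewrite mE -wE w0 !add0m.
  apply/mnmP=> i; rewrite mnm0E; apply/eqP; apply: contrapT => /negP wi.
  have := disj i; rewrite mE -wE !mnmDE; move: wi.
  by case: (w i) => // wi' _; rewrite !addSn => /(_ isT).
have [v1 [v2 [nv hE]]] := Sbin _ hS.
have sfv : same_fiber a v1 v2 by apply/(toric_binomial K lattice_ge0); rewrite -hE.
move: uh; rewrite hE msupp_binomial // => /orP[]/eqP uE; rewrite uE in m1E.
  by have [<- <-] := swap v1 v2 m1E nv sfv; left; rewrite -hE.
rewrite eq_sym in nv; have [<- <-] := swap v2 v1 m1E nv (same_fiber_sym sfv).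
by right; rewrite opprB -hE.
Qed.


Section K4Fiber.
Variable f : V -> 'I_4.
Hypothesis fP : k4_colouring e f.

(** The eight cuts of K4, by the sides of the vertices 1, 2, 3 relative to the
    vertex 0. *)
Definition side (t : bool * bool * bool) (c : 'I_4) : bool :=
  nth false [:: false; t.1.1; t.1.2; t.2] c.

Definition side_set t : {set V} := [set v | side t (f v)]%SET.

Definition k4_index t := cut_index (side_set t).

Lemma cut_side_set p t : cut p (side_set t) = side t (f p.1) (+) side t (f p.2).
Proof. by rewrite /cut !inE. Qed.

Lemma class_edge c c' : c != c' -> exists j p,
  [/\ f p.1 = c, f p.2 = c' & forall S, cut_bits S j = cut p S].
Proof.
move=> cc; have [x [y [xc yc xy]]] := fP.2 c c' cc.
by have [j jp] := @cut_bits_edge (x, y) xy; exists j, (x, y).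
Qed.

Lemma cut_index_bits S T : cut_index S = cut_index T -> cut_bits S =1 cut_bits T.
Proof.
move=> ST j; have := congr1 (fun i => `|a i 0%R j|%N) ST; rewrite !cut_index_abs.
by case: (cut_bits S j) (cut_bits T j) => [] [].
Qed.

Lemma k4_index_inj : injective k4_index.
Proof.
move=> t t' /cut_index_bits tt'.
have sides c : c != ord0 -> side t c = side t' c.
  rewrite eq_sym => /class_edge[j [p [p1 p2 jp]]].
  by have := tt' j; rewrite !jp !cut_side_set p1 p2.
have := sides (inord 1); have := sides (inord 2); have := sides (inord 3).
rewrite /side -!val_eqE /= !inordK //= => /(_ isT) + /(_ isT) + /(_ isT).
by case: t {tt' sides} => [[? ?] ?]; case: t' => [[? ?] ?] /= -> -> ->.
Qed.

Definition odd_side (t : bool * bool * bool) : bool := t.1.1 (+) t.1.2 (+) t.2.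

(** Both products run over four cuts: the even ones are the empty cut and the three
    cuts separating two vertices from two, the odd ones are the stars of the four
    vertices.  Each of them covers every edge of K4 twice. *)
Definition k4_monomial b : 'X_{1..N} := (\sum_(t | odd_side t == b) U_(k4_index t))%MM.

Lemma sum_sides (F : bool * bool * bool -> nat) : (\sum_t F t =
  F (true, true, true) + F (true, true, false) + F (true, false, true) + F (true, false,
    false)
  + F (false, true, true) + F (false, true, false) + F (false, false, true) + F (false,
    false, false))%N.
Proof.
transitivity (\sum_x \sum_y \sum_z F (x, y, z))%N.
  rewrite pair_bigA pair_bigA /=; apply: eq_bigr => -[[]] //.
by rewrite !big_bool /= !addnA.
Qed.

Lemma k4_monomialE b t : k4_monomial b (k4_index t) = (odd_side t == b).
Proof.
rewrite mnm_sumE big_mkcond (bigD1 t) //= mnm1E eqxx big1 ?addn0 => [|t' t't].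
  by case: (_ == b).
by rewrite mnm1E (inj_eq k4_index_inj) (negPf t't); case: ifP.
Qed.

Lemma k4_monomial0 b i : (forall t, k4_index t != i) -> k4_monomial b i = 0%N.
Proof. by move=> ni; rewrite mnm_sumE big1 // => t _; rewrite mnm1E (negPf (ni t)). Qed.

Lemma mdeg_k4_monomial b : mdeg (k4_monomial b) = 4.
Proof.
rewrite /k4_monomial mdeg_sum big_mkcond sum_sides /odd_side /= !mdeg1.
by case: b.
Qed.

Lemma weight_k4_monomial b j p : (forall S, cut_bits S j = cut p S) ->
  weight a (k4_monomial b) j = ((f p.1 != f p.2) * 2)%N.
Proof.
move=> jp; transitivity (\sum_(t | odd_side t == b) cut p (side_set t))%N.
  have w0 : weight a 0%MM j = 0%N by rewrite /weight big1 // => i _; rewrite mnm0E.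
  rewrite (big_morph (fun m => weight a m j) (fun m1 m2 => weightD a m1 m2 j) w0).
  by apply: eq_bigr => t _; rewrite weightU cut_index_abs jp.
rewrite big_mkcond sum_sides !cut_side_set /odd_side /side /=.
by case: (f p.1) (f p.2) b => [[|[|[|[|?]]]] ?] [[|[|[|[|?]]]] ?] [].
Qed.

Lemma same_fiber_k4 : same_fiber a (k4_monomial false) (k4_monomial true).
Proof.
split=> [|j]; first by rewrite !mdeg_k4_monomial.
by have [p _ jp] := edge_cut_bits j; rewrite !(weight_k4_monomial _ jp).
Qed.

(** Edges inside a branch set are not covered in this fibre, so every cut that
    occurs is constant on the branch sets, since these are connected. *)
Lemma k4_fiber_support m i : same_fiber a (k4_monomial false) m -> m i != 0%N ->
  exists t, k4_index t = i.
Proof.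
move=> [_ eqw] mi; pose S := cut_set i.
have inner p : e p.1 p.2 -> f p.1 = f p.2 -> cut p S = false.
  move=> /cut_bits_edge[j jp] fp; have := eqw j.
  rewrite (weight_k4_monomial _ jp) fp eqxx => /esym/eqP.
  rewrite sum_nat_eq0 => /forallP/(_ i); rewrite lattice_abs jp muln_eq0 (negPf mi) /=.
  by case: (cut p _).
have const x y : f x = f y -> (x \in S) = (y \in S).
  have half u v : f u = f v -> u \in S -> v \in S.
    move=> uv uS; apply/negP => /negP vS.
    have [||x' [y' [xy]]] := connected_exit (fP.1 (f u)) _ _ uS vS.
    - by rewrite inE.
    - by rewrite inE uv.
    rewrite !inE => /eqP xu /eqP yu xS yS.
    have := inner (x', y') xy (etrans xu (esym yu)).
    by rewrite /cut /= xS (negPf yS).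
  by move=> xy; apply/idP/idP; apply: half.
have rep c : exists x, f x == c.
  by have [/set0Pn[x]] := fP.1 c; rewrite inE => fx; exists x.
pose r c := xchoose (rep c); have fr c : f (r c) = c by apply/eqP/(xchooseP (rep c)).
pose s c := (r c \in S) (+) (r ord0 \in S).
exists (s (inord 1), s (inord 2), s (inord 3)); apply: cut_index_eq => j.
have [p pe jp] := edge_cut_bits j; rewrite !jp cut_side_set.
have sideE c : side (s (inord 1), s (inord 2), s (inord 3)) c = s c.
  have cE (q : nat) : (q < 4)%N -> val c = q -> c = inord q by move=> lt cq; apply:
    val_inj; rewrite /= inordK.
  case: c cE => [[|[|[|[|?]]]] lt] // cE.
  - by rewrite /s (_ : Ordinal lt = ord0) ?addbb //; apply: val_inj.
  - by rewrite [in RHS](cE 1%N lt erefl).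
  - by rewrite [in RHS](cE 2%N lt erefl).
  - by rewrite [in RHS](cE 3%N lt erefl).
rewrite !sideE /s /cut !(const (r (f _)) _ (fr _)).
by case: (_ \in S) (_ \in S) (_ \in S) => [] [] [].
Qed.

(** The multiplicities of the eight cuts satisfy one linear equation for the degree
    and one for each edge of K4; they have exactly two solutions in natural
    numbers. *)
Lemma k4_fiber m : same_fiber a (k4_monomial false) m ->
  m = k4_monomial false \/ m = k4_monomial true.
Proof.
move=> sf; have supp i : m i != 0%N -> exists t, k4_index t = i by apply: k4_fiber_support.
have sumE (F : 'I_N -> nat) : (\sum_i m i * F i = \sum_t m (k4_index t) * F (k4_index t))%N.
  transitivity (\sum_i \sum_(t | k4_index t == i) m i * F i)%N.
    apply: eq_bigr => i _; case: (eqVneq (m i) 0%N) => [->|/supp[t <-]].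
      by rewrite big1.
    by rewrite (big_pred1 t) // => t'; rewrite (inj_eq k4_index_inj).
  rewrite (exchange_big_dep xpredT) //=; apply: eq_bigr => t _.
  by rewrite (big_pred1 (k4_index t)).
pose n x y z := m (k4_index (x, y, z)).
have total4 : (n true true true + n true true false + n true false true + n true false false
  + n false true true + n false true false + n false false true + n false false false = 4)%N.
  have [+ _] := sf; rewrite mdeg_k4_monomial mdegE => /esym d4; apply: etrans d4.
  rewrite (eq_bigr (fun i => m i * 1)%N) => [|i _]; last by rewrite muln1.
  by rewrite (sumE (fun=> 1%N)) sum_sides !muln1.
have edge2 c c' : c != c' ->
  (n true true true * (side (true, true, true) c (+) side (true, true, true) c')
   + n true true false * (side (true, true, false) c (+) side (true, true, false) c')
   + n true false true * (side (true, false, true) c (+) side (true, false, true) c')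
   + n true false false * (side (true, false, false) c (+) side (true, false, false) c')
   + n false true true * (side (false, true, true) c (+) side (false, true, true) c')
   + n false true false * (side (false, true, false) c (+) side (false, true, false) c')
   + n false false true * (side (false, false, true) c (+) side (false, false, true) c')
   + n false false false * (side (false, false, false) c (+) side (false, false, false) c')
     = 2)%N.
  move=> cc; have [j [p [p1 p2 jp]]] := class_edge cc; have [_ /(_ j)] := sf.
  rewrite (weight_k4_monomial _ jp) p1 p2 cc mul1n => /esym w2; apply: etrans w2.
  by rewrite /weight sumE sum_sides !cut_index_abs !jp !cut_side_set p1 p2.
have neq (x y : nat) : (x < 4)%N -> (y < 4)%N -> x != y -> inord x != inord y :> 'I_4.
  by move=> x4 y4; rewrite -val_eqE /= !inordK.
have e01 := edge2 _ _ (neq 0%N 1%N isT isT isT); have e02 := edge2 _ _ (neq 0%N 2%N isT isT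
  isT).
have e03 := edge2 _ _ (neq 0%N 3%N isT isT isT); have e12 := edge2 _ _ (neq 1%N 2%N isT isT
  isT).
have e13 := edge2 _ _ (neq 1%N 3%N isT isT isT); have e23 := edge2 _ _ (neq 2%N 3%N isT isT
  isT).
rewrite /side /= !inordK //= ?muln0 ?muln1 ?addn0 ?add0n in e01 e02 e03 e12 e13 e23.
have sol : exists b, forall x y z, n x y z = (odd_side (x, y, z) == b).
  have [tt|tt] : n true true true = 0%N \/ n true true true = 1%N by lia.
    by exists false => -[] [] []; rewrite /odd_side /=; lia.
  by exists true => -[] [] []; rewrite /odd_side /=; lia.
have [b nE] := sol; suff -> : m = k4_monomial b by case: b {nE}; [right | left].
apply/mnmP=> i; case: (pselect (exists t, k4_index t = i)) => [[[[x y] z] <-]|no].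
  by rewrite k4_monomialE -nE.
rewrite k4_monomial0 => [|t]; last by apply/eqP=> ti; apply: no; exists t.
by apply/eqP; apply: contrapT => /negP/supp.
Qed.

Lemma k4_indispensable :
  exists g : {mpoly K[N]}, indispensable_binomial I g /\ (3 <= (msize g).-1)%N.
Proof.
have disj i : k4_monomial false i != 0%N -> k4_monomial true i = 0%N.
  case: (pselect (exists t, k4_index t = i)) => [[t <-]|no _].
    by rewrite !k4_monomialE; case: (odd_side t).
  by apply: k4_monomial0 => t; apply/eqP=> ti; apply: no; exists t.
have neq : k4_monomial false != k4_monomial true.
  apply/eqP=> /mnmP/(_ (k4_index (false, false, false))).
  by rewrite !k4_monomialE.
exists ('X_[k4_monomial false] - 'X_[k4_monomial true]); split.
  exact: indispensable_of_fiber same_fiber_k4 k4_fiber disj.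
have : k4_monomial false \in msupp ('X_[k4_monomial false] - 'X_[k4_monomial true] : {mpoly
  K[N]}).
  by rewrite msupp_binomial // eqxx.
by move/msize_mdeg_lt; rewrite mdeg_k4_monomial; lia.
Qed.

End K4Fiber.
End CutIdeal.

Theorem theorem3p15 (R : realType) (K : fieldType)
    (V : finType) (e : rel V)
    (e_sym : ssrbool.symmetric e) (e_irr : irreflexive e) (e_conn : connected_graph e)
    (N : nat) (a : 'I_N -> 'rV[int]_#|edge_set e|)
    (a_enum : lattice_points (cut_polytope R e) a) :
  [<-> ~ has_minor e (complete_graph 4);
       quadratic (toric_ideal K a);
       clique_face_property (cut_polytope R e);
       ~ (exists m : 'X_{1..N},
            indispensable_monomial (toric_ideal K a) m /\ (3 <= mdeg m)%N);
       ~ (exists f : {mpoly K[N]},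
            indispensable_binomial (toric_ideal K a) f /\
            (3 <= (msize f).-1)%N)].
Proof.
tfae.
- by move=> noK4; exact: (quadratic_of_fibers_connected K e_irr a_enum
  (fibers_connected_k4_free e_sym e_irr e_conn noK4)).
- exact: clique_face_of_quadratic.
- exact: no_indispensable_monomial.
- exact: (no_indispensable_binomial a_enum).
- move=> no K4; apply: no; have [f fP] := k4_colouring_exists e_sym e_conn K4.
  exact: (k4_indispensable K e_irr a_enum fP).
Qed.
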